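(* Let $(W_\Pi,\Pi)$ be a Coxeter system, $\Gamma_\Pi$ a subgroup of $\mathrm{Aut}(\Pi)$, $J\subseteq\Pi$ a spherical subset, $\Gamma_J$ a subgroup of $\mathrm{Aut}(J)$, and $R$ a normal subgroup of $\Gamma_J$. Let $\Gamma_\Omega$ be the group defined in the context. Then the kernel of the natural map from $\Gamma_\Omega$ to $\Gamma_J\times\Gamma_\Pi$ has finite cohomological dimension.
   Context: $\Pi$ may be infinite; $m_{st}$ is the order of $st$. A subset of $\Pi$ is spherical if it generates a finite group. $\mathrm{Aut}(\Pi)$ is the group of permutations of $\Pi$ preserving all $m_{st}$ (similarly $\mathrm{Aut}(J)$). $V_\Pi$ is the real vector space with basis $e_s$ ($s\in\Pi$) and symmetric bilinear form $(e_s,e_t)=2\cos(\pi/m_{st})$ (with $\pi/\infty=0$). $W_\Pi$ acts on $V_\Pi$, $s$ acting by $v\mapsto v+(v,e_s)e_s$, and $\Gamma_\Pi$ acts by permuting the $e_s$, so the semidirect product $W_\Pi.\Gamma_\Pi$ (with $W_\Pi$ normal) acts on $V_\Pi$ and on the dual $V_\Pi^*$. $\Delta^+$ is the set of positive roots. Put $$C_\Pi=\{x\in V_\Pi^*: x(e_s)\ge0\ \text{for all } s\in\Pi,\ x(r)>0\ \text{for all but finitely many } r\in\Delta^+\},\qquad X=\bigcup_{w\in W_\Pi}w(C_\Pi).$$ $W_J$ is the subgroup generated by $J$, and $V_\Pi^{*W_J}$ is the subspace of $V_\Pi^*$ fixed by $W_J$. $W'_J$ is the group of $g\in W_\Pi.\Gamma_\Pi$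 for which there is $\gamma\in\Gamma_J$ with $g(e_j)=e_{\gamma(j)}$ for all $j\in J$ (one says $g$ acts on $J$ as $\gamma$). $W_\Omega$ is the subgroup of $W_\Pi\cap W'_J$ generated by the elements $w\in W_\Pi\cap W'_J$ that act on $V_\Pi^{*W_J}$ as a reflection and act on $J$ as an element of $R$. $C_\Omega$ is its fundamental chamber: the set of $y\in X\cap V_\Pi^{*W_J}$ not strictly separated from $C_\Pi\cap V_\Pi^{*W_J}$ by any reflection hyperplane of $W_\Omega$ in $V_\Pi^{*W_J}$. $\Gamma_\Omega=\{w\in W'_J:w(C_\Omega)=C_\Omega\}$. The natural map $\Gamma_\Omega\to\Gamma_J\times\Gamma_\Pi$ sends $g$ to the pair consisting of its action on $J$ and its image under the projection $W_\Pi.\Gamma_\Pi\to\Gamma_\Pi$. *)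

(* Defs.v *)
From HB Require Import structures.
From mathcomp Require Import all_boot all_order all_algebra.
From mathcomp Require Import finmap.
From mathcomp Require Import boolp classical_sets functions cardinality reals.
From mathcomp Require Import trigo monalg ring.

Set Implicit Arguments.
Unset Strict Implicit.
Unset Printing Implicit Defensive.

Import Order.TTheory GRing.Theory Num.Theory.

Local Open Scope classical_set_scope.
Local Open Scope ring_scope.

Record subgroup (G : groupType) := Subgroup {
  sg_set :> set G;
  sg_set1 : 1%g \in sg_set;
  sg_setM : forall x y, x \in sg_set -> y \in sg_set -> (x * y)%g \in sg_set;
  sg_setV : forall x, x \in sg_set -> (x^-1)%g \in sg_set }.

Record sg_type (G : groupType) (H : subgroup G) := SgElt {
  sg_val : G;
  sg_valP : sg_val \in sg_set H }.

Section SubgroupType.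
Context (G : groupType) (H : subgroup G).

HB.instance Definition _ := [isSub of sg_type H for @sg_val G H].
HB.instance Definition _ := [Choice of sg_type H by <:].

Definition sg_one : sg_type H := SgElt (sg_set1 H).
Definition sg_inv (x : sg_type H) : sg_type H :=
  SgElt (sg_setV (sg_valP x)).
Definition sg_mul (x y : sg_type H) : sg_type H :=
  SgElt (sg_setM (sg_valP x) (sg_valP y)).

Lemma sg_mulA : associative sg_mul.
Proof. by move=> x y z; apply/val_inj; rewrite /= mulgA. Qed.
Lemma sg_mul1g : left_id sg_one sg_mul.
Proof. by move=> x; apply/val_inj; rewrite /= mul1g. Qed.
Lemma sg_mulg1 : right_id sg_one sg_mul.
Proof. by move=> x; apply/val_inj; rewrite /= mulg1. Qed.
Lemma sg_mulVg : left_inverse sg_one sg_inv sg_mul.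
Proof. by move=> x; apply/val_inj; rewrite /= mulVg. Qed.
Lemma sg_mulgV : right_inverse sg_one sg_inv sg_mul.
Proof. by move=> x; apply/val_inj; rewrite /= mulgV. Qed.

HB.instance Definition _ := isGroup.Build (sg_type H)
  sg_mulA sg_mul1g sg_mulg1 sg_mulVg sg_mulgV.

End SubgroupType.

Definition is_subgroup (G : groupType) (A : set G) : Prop :=
  [/\ 1%g \in A, forall x y, x \in A -> y \in A -> (x * y)%g \in A
    & forall x, x \in A -> (x^-1)%g \in A].

Definition generated (G : groupType) (A : set G) : set G :=
  smallest (@is_subgroup G) A.

Definition normal_in (G : groupType) (N H : subgroup G) : Prop :=
  N `<=` H /\
  forall h n, h \in sg_set H -> n \in sg_set N -> (h * n * h^-1)%g \in sg_set N.

Section Kernel.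
Context (G H : groupType) (f : UMagmaMorphism.type G H).

Definition ker_set : set G := [set x | f x = 1%g].

Lemma ker_set1 : 1%g \in ker_set.
Proof. by rewrite inE /ker_set /= gmulf1. Qed.
Lemma ker_setM x y : x \in ker_set -> y \in ker_set -> (x * y)%g \in ker_set.
Proof. by rewrite !inE /ker_set /= gmulfM => -> ->; rewrite mulg1. Qed.
Lemma ker_setV x : x \in ker_set -> (x^-1)%g \in ker_set.
Proof. by rewrite !inE /ker_set /= gmulfV => ->; rewrite invg1. Qed.

Definition ker : subgroup G := Subgroup ker_set1 ker_setM ker_setV.

End Kernel.

Record bijection (T : Type) := Bijection {
  bij_fun :> T -> T;
  bij_inv : T -> T;
  bij_funK : cancel bij_fun bij_inv;
  bij_invK : cancel bij_inv bij_fun }.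

Section BijectionGroup.
Context (T : Type).
Implicit Types f g h : bijection T.

Lemma bijP f g : bij_fun f =1 bij_fun g -> f = g.
Proof.
case: f g => f f' fK f'K [g g' gK g'K] /= /funext fg; subst g.
have fg : f' = g' by apply/funext => x; rewrite -[in RHS](f'K x) gK.
by subst g'; congr Bijection; exact: Prop_irrelevance.
Qed.

HB.instance Definition _ := gen_eqMixin (bijection T).
HB.instance Definition _ := gen_choiceMixin (bijection T).

Definition bij_one : bijection T :=
  @Bijection T id id (fun=> erefl) (fun=> erefl).
Definition bij_opp f : bijection T := Bijection (bij_invK f) (bij_funK f).
Definition bij_comp f g : bijection T :=
  Bijection (can_comp (bij_funK f) (bij_funK g))
            (can_comp (bij_invK g) (bij_invK f)).

Lemma bij_compA : associative bij_comp. Proof. by move=> f g h; exact: bijP. Qed.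
Lemma bij_comp1g : left_id bij_one bij_comp.
Proof. by move=> f; exact: bijP. Qed.
Lemma bij_compg1 : right_id bij_one bij_comp.
Proof. by move=> f; exact: bijP. Qed.
Lemma bij_compVg : left_inverse bij_one bij_opp bij_comp.
Proof. by move=> f; apply: bijP => x /=; rewrite bij_funK. Qed.
Lemma bij_compgV : right_inverse bij_one bij_opp bij_comp.
Proof. by move=> f; apply: bijP => x /=; rewrite bij_invK. Qed.

HB.instance Definition _ := isGroup.Build (bijection T)
  bij_compA bij_comp1g bij_compg1 bij_compVg bij_compgV.

Lemma bijM f g x : (f * g)%g x = f (g x). Proof. by []. Qed.
Lemma bij1 x : (1%g : bijection T) x = x. Proof. by []. Qed.

Context (m : T -> T -> nat).

Definition aut_set : set (bijection T) :=
  [set f | forall a b, m (f a) (f b) = m a b].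

Lemma aut_set1 : 1%g \in aut_set.
Proof. by rewrite inE. Qed.
Lemma aut_setM f g : f \in aut_set -> g \in aut_set -> (f * g)%g \in aut_set.
Proof. by rewrite !inE => mf mg a b; rewrite !bijM mf mg. Qed.
Lemma aut_setV f : f \in aut_set -> (f^-1)%g \in aut_set.
Proof.
rewrite !inE => mf a b.
by rewrite -mf -!bijM mulgV.
Qed.

Definition aut : subgroup (bijection T) := Subgroup aut_set1 aut_setM aut_setV.

Definition aut_fun (f : sg_type aut) : T -> T := val f.

Lemma aut_fun_m (f : sg_type aut) a b : m (aut_fun f a) (aut_fun f b) = m a b.
Proof. by have := valP f; rewrite inE; exact. Qed.

End BijectionGroup.

(* The order of x, or 0 if x has infinite order. *)
Definition gorder (G : groupType) (x : G) : nat :=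
  if pselect (exists n, (0 < n)%N && (x ^+ n == 1)%g) is left h
  then ex_minn h else 0%N.

(* In cs_pres the relation is void when the order of st is infinite, since
   gorder is then 0. *)
Record coxeter_system := CoxeterSystem {
  cs_group : groupType;
  cs_index : choiceType;
  cs_gen : cs_index -> cs_group;
  cs_gen_inj : injective cs_gen;
  cs_gen_neq1 : forall s, cs_gen s != 1%g;
  cs_gen_sq : forall s, (cs_gen s * cs_gen s)%g = 1%g;
  cs_generated : generated (range cs_gen) = setT;
  cs_pres : forall (H : groupType) (f : cs_index -> H),
    (forall s t, ((f s * f t) ^+ gorder (cs_gen s * cs_gen t) = 1)%g) ->
    exists phi : cs_group -> H,
      {morph phi : x y / (x * y)%g} /\ forall s, phi (cs_gen s) = f s }.

Section Coxeter.
Context (S : coxeter_system).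

Notation W := (cs_group S).
Notation Pi := (cs_index S).
Notation gen := (@cs_gen S).

Definition cox_m (s t : Pi) : nat := gorder (gen s * gen t)%g.

Definition diagram_aut := sg_type (aut cox_m).
HB.instance Definition _ := Group.on diagram_aut.

Lemma gen_ind (P : W -> Prop) :
  P 1%g -> (forall s, P (gen s)) -> (forall x y, P x -> P y -> P (x * y)%g) ->
  (forall x, P x -> P (x^-1)%g) -> forall w, P w.
Proof.
move=> P1 Ps PM PV w.
have : generated (range gen) w by rewrite cs_generated.
apply; split => [|_ [s _ <-]]; last exact: Ps.
split; rewrite ?inE//= => x; first by move=> y; rewrite !inE; exact: PM.
by rewrite !inE; exact: PV.
Qed.

Lemma morph_mulg1 (G H : groupType) (f : G -> H) :
  {morph f : x y / (x * y)%g} -> f 1%g = 1%g.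
Proof. by move=> fM; apply: (mulgI (f 1%g)); rewrite -fM !mulg1. Qed.

Lemma morph_mulgV (G H : groupType) (f : G -> H) :
  {morph f : x y / (x * y)%g} -> {morph f : x / (x^-1)%g}.
Proof.
move=> fM x; apply: (mulgI (f x)).
by rewrite -fM !mulgV morph_mulg1.
Qed.

Lemma gen_morph_eq (H : groupType) (f g : W -> H) :
  {morph f : x y / (x * y)%g} -> {morph g : x y / (x * y)%g} ->
  (forall s, f (gen s) = g (gen s)) -> f =1 g.
Proof.
move=> fM gM fg; apply: gen_ind => //.
- by rewrite !morph_mulg1.
- by move=> x y xE yE; rewrite fM gM xE yE.
- by move=> x xE; rewrite !morph_mulgV// xE.
Qed.

Lemma cox_aut_subproof (f : diagram_aut) : exists phi : W -> W,
  {morph phi : x y / (x * y)%g} /\ forall s, phi (gen s) = gen (aut_fun f s).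
Proof.
apply: (@cs_pres S W (fun s => gen (aut_fun f s))) => s t.
rewrite -[gorder _]/(cox_m s t) -(aut_fun_m f) /cox_m /gorder.
by case: pselect => // h; case: ex_minnP => n /andP[_ /eqP].
Qed.

Definition cox_aut (f : diagram_aut) : W -> W :=
  projT1 (cid (cox_aut_subproof f)).

Lemma cox_autM (f : diagram_aut) : {morph cox_aut f : x y / (x * y)%g}.
Proof. by rewrite /cox_aut; case: cid => phi []. Qed.

Lemma cox_aut_gen (f : diagram_aut) s :
  cox_aut f (gen s) = gen (aut_fun f s).
Proof. by rewrite /cox_aut; case: cid => phi []. Qed.

Lemma cox_aut_mul (f g : diagram_aut) w :
  cox_aut (f * g)%g w = cox_aut f (cox_aut g w).
Proof.
move: w; apply: gen_morph_eq; first exact: cox_autM.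
- by move=> x y; rewrite !cox_autM.
- by move=> s; rewrite !cox_aut_gen.
Qed.

Lemma cox_aut_one w : cox_aut 1%g w = w.
Proof.
by move: w; apply: gen_morph_eq => // [|s]; [exact: cox_autM|rewrite cox_aut_gen].
Qed.

Lemma cox_autK (f : diagram_aut) w : cox_aut f (cox_aut f^-1%g w) = w.
Proof. by rewrite -cox_aut_mul mulgV cox_aut_one. Qed.

(* The semidirect product by the full group Aut(Pi); W_Pi.Gamma_Pi is the
   subgroup of the g with sd_aut g in Gamma_Pi. *)
Record semidirect := Semidirect { sd_cox : W; sd_aut : diagram_aut }.

HB.instance Definition _ := gen_eqMixin semidirect.
HB.instance Definition _ := gen_choiceMixin semidirect.

Definition sd_one := Semidirect 1%g 1%g.
Definition sd_mul g h :=
  Semidirect (sd_cox g * cox_aut (sd_aut g) (sd_cox h))%g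
             (sd_aut g * sd_aut h)%g.
Definition sd_inv g :=
  Semidirect (cox_aut (sd_aut g)^-1 (sd_cox g)^-1)%g (sd_aut g)^-1%g.

Lemma sd_mulA : associative sd_mul.
Proof.
by move=> g h k; rewrite /sd_mul /= cox_autM cox_aut_mul !mulgA.
Qed.
Lemma sd_mul1g : left_id sd_one sd_mul.
Proof. by case=> w f; rewrite /sd_mul /= cox_aut_one !mul1g. Qed.
Lemma sd_mulg1 : right_id sd_one sd_mul.
Proof.
by case=> w f; rewrite /sd_mul /= (morph_mulg1 (cox_autM f)) !mulg1.
Qed.
Lemma sd_mulVg : left_inverse sd_one sd_inv sd_mul.
Proof.
case=> w f; rewrite /sd_mul /= -cox_autM !mulVg.
by rewrite (morph_mulg1 (cox_autM _)).
Qed.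
Lemma sd_mulgV : right_inverse sd_one sd_inv sd_mul.
Proof. by case=> w f; rewrite /sd_mul /= cox_autK !mulgV. Qed.

HB.instance Definition _ := isGroup.Build semidirect
  sd_mulA sd_mul1g sd_mulg1 sd_mulVg sd_mulgV.

End Coxeter.

Section LinearExtension.
Context (R : realType) (K : choiceType) (U : lmodType R) (h : K -> U).

Definition lin_ext (v : {malg R[K]}) : U := \sum_(k <- msupp v) v@_k *: h k.

Lemma lin_ext_sub (d : {fset K}) v : (msupp v `<=` d)%fset ->
  lin_ext v = \sum_(k <- d) v@_k *: h k.
Proof.
move=> vd; rewrite [LHS](big_fset_incl _ vd) => //= x _ /mcoeff_outdom ->.
by rewrite scale0r.
Qed.

Lemma mcoeffZ (a : R) (v : {malg R[K]}) k : (a *: v)@_k = a * v@_k.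
Proof. exact: fgscaleE. Qed.

Lemma lin_ext_linear : linear lin_ext.
Proof.
move=> a u v; set w := a *: u + v.
set d := (msupp u `|` msupp v `|` msupp w)%fset.
have du : (msupp u `<=` d)%fset by apply/fsubsetP => i; rewrite !inE => ->.
have dv : (msupp v `<=` d)%fset.
  by apply/fsubsetP => i; rewrite !inE => ->; rewrite orbT.
have dw : (msupp w `<=` d)%fset.
  by apply/fsubsetP => i; rewrite !inE => ->; rewrite orbT.
rewrite (lin_ext_sub du) (lin_ext_sub dv) (lin_ext_sub dw).
rewrite scaler_sumr -big_split/=; apply: eq_bigr => k _.
by rewrite mcoeffD mcoeffZ scalerDl scalerA.
Qed.

HB.instance Definition _ :=
  GRing.isLinear.Build R {malg R[K]} U *:%R lin_ext lin_ext_linear.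

Lemma lin_extU k : lin_ext << k >> = h k.
Proof. by rewrite (lin_ext_sub msuppU_le) big_seq_fset1 mcoeffUU scale1r. Qed.

Lemma lin_ext_unique (g : {malg R[K]} -> U) : linear g ->
  (forall k, g << k >> = h k) -> g =1 lin_ext.
Proof.
move=> glin gh v; pose G : {linear _ -> _} := HB.pack g (GRing.isLinear.Build _ _ _ _ g glin).
have -> : g v = G v by [].
rewrite [in LHS](monalgE v) linear_sum; apply: eq_bigr => k _.
have -> : << v@_k *g k >> = v@_k *: << k >> :> {malg R[K]}.
  by apply/malgP => i; rewrite mcoeffZ !mcoeffU mulr_natr.
by rewrite linearZ -[G _]/(g _) gh.
Qed.

End LinearExtension.

Lemma malg_linear_eq (R : realType) (K : choiceType) (U : lmodType R)
    (f g : {malg R[K]} -> U) : linear f -> linear g ->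
  (forall k, f << k >> = g << k >>) -> f =1 g.
Proof.
move=> fl gl fg v.
rewrite (@lin_ext_unique _ _ _ (fun k => g << k >>) f)//.
by rewrite -(@lin_ext_unique _ _ _ (fun k => g << k >>) g).
Qed.

Section Geometric.
Context (R : realType) (S : coxeter_system).

Notation W := (cs_group S).
Notation Pi := (cs_index S).
Notation gen := (@cs_gen S).

Definition cox_V := {malg R[Pi]}.
HB.instance Definition _ := GRing.Lmodule.on cox_V.

Definition simple_root (s : Pi) : cox_V := << s >>.

(* If m_st is infinite then cox_m s t = 0, and pi / 0 = 0 as required. *)
Definition cox_form (v w : cox_V) : R :=
  \sum_(s <- msupp v) \sum_(t <- msupp w)
    v@_s * w@_t * (2 * cos (pi / (cox_m s t)%:R)).

Definition refl (s : Pi) (v : cox_V) : cox_V :=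
  v + cox_form v (simple_root s) *: simple_root s.

Lemma cox_mC (s t : Pi) : cox_m s t = cox_m t s.
Proof.
have key (x y : W) n : ((x * y) ^+ n = 1 -> (y * x) ^+ n = 1)%g.
  have conj : forall n, (((y * x) ^+ n) * y = y * (x * y) ^+ n)%g.
    elim=> [|k IH]; first by rewrite mul1g mulg1.
    by rewrite !expgSr [RHS]mulgA -IH !mulgA.
  by move=> xy; apply: (mulIg y); rewrite conj xy mulg1 mul1g.
rewrite /cox_m /gorder; case: pselect => [h|h]; case: pselect => [h'|h'] //.
- case: ex_minnP => m /andP[m0 /eqP mE] mmin.
  case: ex_minnP => n /andP[n0 /eqP nE] nmin.
  by apply/eqP; rewrite eqn_leq mmin ?nmin ?m0 ?n0 ?(key _ _ _ nE) ?(key _ _ _ mE) ?eqxx.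
- by case: h'; case: h => n /andP[n0 /eqP nE]; exists n; rewrite n0 (key _ _ _ nE) eqxx.
- by case: h; case: h' => n /andP[n0 /eqP nE]; exists n; rewrite n0 (key _ _ _ nE) eqxx.
Qed.

Lemma cox_m_diag (s : Pi) : cox_m s s = 1%N.
Proof.
rewrite /cox_m cs_gen_sq /gorder; case: pselect => [h|[]].
  case: ex_minnP => n /andP[n0 _] /(_ 1%N); rewrite expg1 eqxx => /(_ isT).
  by case: n n0 => [|[|]].
by exists 1%N; rewrite expg1 eqxx.
Qed.

Lemma cox_formE v t : cox_form v (simple_root t) =
  lin_ext (fun s => 2 * cos (pi / (cox_m s t)%:R) : R^o) v.
Proof.
apply: eq_bigr => s _; rewrite msuppU oner_eq0 big_seq_fset1.
by rewrite mcoeffUU mulr1.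
Qed.

Lemma cox_form_linear t : linear (fun v => cox_form v (simple_root t) : R^o).
Proof. by move=> a u v; rewrite !cox_formE linearP. Qed.

Lemma cox_form_root s t :
  cox_form (simple_root s) (simple_root t) = 2 * cos (pi / (cox_m s t)%:R).
Proof. by rewrite cox_formE lin_extU. Qed.

Lemma refl_linear s : linear (refl s).
Proof.
move=> a u v; rewrite /refl cox_form_linear scalerDr scalerDl addrACA.
by rewrite scalerA.
Qed.

Lemma cox_form_rootss s : cox_form (simple_root s) (simple_root s) = - 2.
Proof. by rewrite cox_form_root cox_m_diag divr1 cospi mulrN1. Qed.

Lemma reflK s : involutive (refl s).
Proof.
move=> v; rewrite {1}/refl.
have -> : cox_form (refl s v) (simple_root s) = - cox_form v (simple_root s).
  rewrite /refl addrC cox_form_linear cox_form_rootss.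
  by rewrite /GRing.scale/=; ring.
by rewrite /refl scaleNr addrK.
Qed.

Definition refl_bij s : bijection cox_V := Bijection (reflK s) (reflK s).

Lemma lincomb_step (U : lmodType R) (v x y : U) (a b k l : R) :
  v + a *: x + b *: y + k *: y + l *: x = v + (a + l) *: x + (b + k) *: y.
Proof.
rewrite -[in LHS](addrA _ (b *: y)) -scalerDl addrAC -[in LHS](addrA v).
by rewrite -scalerDl.
Qed.

Lemma refl_iter (s t : Pi) v n :
  let th := pi / (cox_m s t)%:R : R in
  let p := cox_form v (simple_root s) in let q := cox_form v (simple_root t) in
  let u := ((refl_bij s * refl_bij t) ^+ n)%g v in
  let x := n%:R * th in
  exists a b : R, [/\ u = v + a *: simple_root s + b *: simple_root t,
    2 * sin th ^+ 2 * a =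
      q * (cos th - cos (2 * x + th)) + p * (1 - cos (2 * x)),
    2 * sin th ^+ 2 * b =
      q * (1 - cos (2 * x)) + p * (cos th - cos (2 * x - th)),
    sin th * cox_form u (simple_root s) =
      - (sin (2 * x) * q + sin (2 * x - th) * p)
  & sin th * cox_form u (simple_root t) =
      sin (2 * x + th) * q + sin (2 * x) * p].
Proof.
move=> th p q; set c := 2 * cos th.
have CS : cos th ^+ 2 = 1 - sin th ^+ 2 by rewrite cos2sin2.
have fst' : cox_form (simple_root s) (simple_root t) = c by rewrite cox_form_root.
have fts : cox_form (simple_root t) (simple_root s) = c by rewrite cox_form_root cox_mC.
elim: n => [|n IH] u x.
  exists 0, 0; rewrite /u /x mul0r !mulr0 !(add0r, addr0, scale0r) cos0 sin0.
  by rewrite sinN cosN; split=> //; rewrite -/p -/q; ring.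
have {IH} := IH; set u0 := bij_fun ((_ ^+ n)%g) v; set y := n%:R * th.
case=> a [b [uE aE bE pE qE]].
set pn := cox_form u0 (simple_root s) in pE *; set qn := cox_form u0 (simple_root t) in qE *.
have xE : 2 * x = 2 * y + th + th by rewrite /x /y -natr1; ring.
have ft : cox_form (refl t u0) (simple_root s) = pn + c * qn.
  rewrite /refl -/qn addrC cox_form_linear fts -/pn.
  by rewrite /GRing.scale/=; ring.
have uS : u = u0 + qn *: simple_root t + (pn + c * qn) *: simple_root s.
  rewrite /u expgS; change (refl s (refl t u0) = u0 + qn *: simple_root t + (pn + c * qn) *: simple_root s).
  by rewrite {1}/refl ft.
exists (a + (pn + c * qn)), (b + qn).
rewrite xE addrK !(sinD, cosD, sinN, cosN) in aE bE pE qE *.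
have pS : cox_form u (simple_root s) = - pn - c * qn.
  rewrite uS addrC cox_form_linear cox_form_rootss addrC [u0 + _]addrC.
  rewrite cox_form_linear fts -/pn.
  by rewrite /GRing.scale/=; ring.
have qS : cox_form u (simple_root t) = c * pn + (c ^+ 2 - 1) * qn.
  rewrite uS addrC cox_form_linear fst' [u0 + _]addrC.
  rewrite cox_form_linear cox_form_rootss -/qn.
  by rewrite /GRing.scale/=; ring.
split.
- by rewrite uS uE; exact: lincomb_step.
- have -> : 2 * sin th ^+ 2 * (a + (pn + c * qn)) =
      2 * sin th ^+ 2 * a +
      2 * sin th * (sin th * pn + c * (sin th * qn)) by ring.
  by rewrite aE pE qE /c; ring: CS.
- have -> : 2 * sin th ^+ 2 * (b + qn) =
      2 * sin th ^+ 2 * b + 2 * sin th * (sin th * qn) by ring.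
  by rewrite bE qE; ring: CS.
- have -> : sin th * cox_form u (simple_root s) =
      - (sin th * pn) - c * (sin th * qn) by rewrite pS; ring.
  by rewrite pE qE /c; ring: CS.
- have -> : sin th * cox_form u (simple_root t) =
      c * (sin th * pn) + (c ^+ 2 - 1) * (sin th * qn) by rewrite qS; ring.
  by rewrite pE qE /c; ring: CS.
Qed.

Lemma refl_rel (s t : Pi) : ((refl_bij s * refl_bij t) ^+ cox_m s t = 1)%g.
Proof.
have [<-|st] := eqVneq s t.
  by rewrite cox_m_diag expg1; apply: bijP => v; exact: reflK.
case: (posnP (cox_m s t)) => [->//|m0].
have m1 : (1 < cox_m s t)%N.
  rewrite ltn_neqAle m0 andbT; apply/eqP => m1; move: st.
  suff -> : s = t by rewrite eqxx.
  apply: (@cs_gen_inj S); have : ((gen s * gen t) ^+ cox_m s t = 1)%g.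
    rewrite /cox_m /gorder; case: pselect => // h.
    by case: ex_minnP => n /andP[_ /eqP].
  by rewrite -m1 expg1 => /eqP; rewrite mulg_eq1 => /eqP ->; apply: (mulgI (gen t)); rewrite cs_gen_sq mulgV.
apply: bijP => v; rewrite bij1.
have := refl_iter s t v (cox_m s t); set th := pi / _.
have mth : (cox_m s t)%:R * th = pi.
  by rewrite /th mulrC divfK// pnatr_eq0 -lt0n.
have sth : sin th != 0.
  rewrite gt_eqF// sin_gt0_pi// divr_gt0 ?pi_gt0 ?ltr0n//=.
  by rewrite ltr_pdivrMr ?ltr0n// ltr_pMr ?pi_gt0// ltr1n.
have pi2 : 2 * pi = pi *+ 2 :> R by rewrite mulr_natl.
rewrite /= mth; case=> a [b [-> aE bE _ _]].
have z (y : R) : 2 * sin th ^+ 2 * y = 0 -> y = 0.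
  by move/eqP; rewrite !mulf_eq0 pnatr_eq0/= (negbTE sth)/= => /eqP.
have -> : a = 0.
  by apply: z; rewrite aE pi2 cosD cos2pi sin2pi; ring.
have -> : b = 0.
  by apply: z; rewrite bE pi2 cosB cos2pi sin2pi; ring.
by rewrite !scale0r !addr0.
Qed.

Lemma geom_subproof : exists phi : W -> bijection cox_V,
  {morph phi : x y / (x * y)%g} /\ forall s, phi (gen s) = refl_bij s.
Proof. exact: cs_pres refl_rel. Qed.

Definition geom : W -> bijection cox_V := projT1 (cid geom_subproof).

Lemma geomM : {morph geom : x y / (x * y)%g}.
Proof. by rewrite /geom; case: cid => phi []. Qed.

Lemma geom_gen s : geom (gen s) = refl_bij s.
Proof. by rewrite /geom; case: cid => phi []. Qed.

Lemma geomK w : cancel (geom w) (geom w^-1%g).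
Proof. by move=> v; rewrite -bijM -geomM mulVg morph_mulg1//; exact: geomM. Qed.

Lemma geom_linear w : linear (geom w).
Proof.
move: w; apply: gen_ind => [||x y xl yl|x xl].
- by rewrite morph_mulg1//; exact: geomM.
- by move=> s a u v; rewrite geom_gen; exact: refl_linear.
- by move=> a u v; rewrite geomM !bijM yl xl.
- move=> a u v; apply: (can_inj (geomK x)); rewrite xl.
  by rewrite -!bijM -geomM mulgV morph_mulg1//; exact: geomM.
Qed.

Definition perm_act (f : diagram_aut S) : cox_V -> cox_V :=
  lin_ext (fun s => simple_root (aut_fun f s)).

Lemma perm_act_root f s : perm_act f (simple_root s) = simple_root (aut_fun f s).
Proof. exact: lin_extU. Qed.

Lemma perm_act_linear f : linear (perm_act f).
Proof. exact: lin_ext_linear. Qed.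

Lemma perm_act1 v : perm_act 1%g v = v.
Proof.
move: v; apply: malg_linear_eq => // [|k]; first exact: perm_act_linear.
exact: perm_act_root.
Qed.

Lemma perm_actM f g v : perm_act (f * g)%g v = perm_act f (perm_act g v).
Proof.
move: v; apply: malg_linear_eq; first exact: perm_act_linear.
- by move=> a u v; rewrite !perm_act_linear.
- by move=> s; rewrite !perm_act_root.
Qed.

Lemma cox_form_perm f v s :
  cox_form (perm_act f v) (simple_root (aut_fun f s)) = cox_form v (simple_root s).
Proof.
move: v; apply: (@malg_linear_eq R Pi R^o); last 1 first.
- by move=> t; rewrite perm_act_root !cox_form_root (aut_fun_m f).
- by move=> a u v; rewrite perm_act_linear cox_form_linear.
- exact: cox_form_linear.
Qed.

Lemma perm_act_refl f s v :
  perm_act f (refl s v) = refl (aut_fun f s) (perm_act f v).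
Proof.
rewrite /refl cox_form_perm addrC perm_act_linear perm_act_root.
by rewrite addrC.
Qed.

Lemma perm_act_geom f w v :
  perm_act f (geom w v) = geom (cox_aut f w) (perm_act f v).
Proof.
move: w v; apply: gen_ind => [v|s v|x y xE yE v|x xE v].
- by rewrite (morph_mulg1 (@cox_autM S f)) (morph_mulg1 geomM).
- by rewrite cox_aut_gen !geom_gen; exact: perm_act_refl.
- by rewrite cox_autM !geomM !bijM xE yE.
- apply: (can_inj (geomK (cox_aut f x))); rewrite -xE.
  rewrite (morph_mulgV (@cox_autM S f)) -!bijM -!geomM !mulgV.
  by rewrite (morph_mulg1 geomM).
Qed.

Definition act (g : semidirect S) (v : cox_V) : cox_V :=
  geom (sd_cox g) (perm_act (sd_aut g) v).

Lemma act_linear g : linear (act g).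
Proof. by move=> a u v; rewrite /act perm_act_linear geom_linear. Qed.

Lemma act1 v : act 1%g v = v.
Proof. by rewrite /act perm_act1 (morph_mulg1 geomM). Qed.

Lemma actM g h v : act (g * h)%g v = act g (act h v).
Proof. by rewrite /act /= geomM bijM perm_actM -perm_act_geom. Qed.

Lemma actK g : cancel (act g) (act g^-1%g).
Proof. by move=> v; rewrite -actM mulVg act1. Qed.

Lemma root_inj : injective simple_root.
Proof.
move=> s t /(congr1 (mcoeff s)); rewrite /simple_root !mcoeffU eqxx.
by case: eqP => // _ /eqP; rewrite oner_eq0.
Qed.

End Geometric.

Section Dual.
Context (R : realType) (V : lmodType R).

Definition lin_forms : {pred V -> R^o} := [pred f | `[< linear f >]].

Lemma lin_forms_submod : submod_closed lin_forms.
Proof.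
split => [|c f g /asboolP fl /asboolP gl]; apply/asboolP => a u v.
  by rewrite scaler0 addr0.
change (c *: f (a *: u + v) + g (a *: u + v) =
  a *: (c *: f u + g u) + (c *: f v + g v)).
rewrite fl gl !scalerDr addrACA; congr (_ + _ + _).
by rewrite !scalerA mulrC.
Qed.

HB.instance Definition _ :=
  GRing.isSubmodClosed.Build R (V -> R^o) lin_forms lin_forms_submod.

Record dual := Dual {
  dual_fun :> V -> R^o;
  dual_fun_linear : dual_fun \in lin_forms }.

HB.instance Definition _ := [isSub for dual_fun].
HB.instance Definition _ := [Choice of dual by <:].
HB.instance Definition _ := [SubChoice_isSubLmodule of dual by <:].

End Dual.

Section ParabolicSubsets.
Context (S : coxeter_system) (J : set (cs_index S)).

Definition parabolic : set (cs_group S) := generated (@cs_gen S @` J).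

Definition spherical : Prop := finite_set parabolic.

Definition sub_m (i j : J) : nat := cox_m (val i) (val j).
Definition sub_aut := sg_type (aut sub_m).
HB.instance Definition _ := Group.on sub_aut.

End ParabolicSubsets.

Section GammaOmega.
Context (R : realType) (S : coxeter_system).

Notation W := (cs_group S).
Notation Pi := (cs_index S).
Notation V := (cox_V R S).
Notation "V^*" := (dual V) (at level 0).
Notation simple_root := (@simple_root R S).
Notation act := (@act R S).

Lemma dact_subproof (g : semidirect S) (x : V^*) :
  (fun v => x (act g^-1%g v)) \in @lin_forms R V.
Proof.
have /asboolP xl := dual_fun_linear x.
by apply/asboolP => a u v; rewrite act_linear xl.
Qed.

Definition dact (g : semidirect S) (x : V^*) : V^* := Dual (dact_subproof g x).

Lemma dualP (x y : V^*) : x =1 y -> x = y.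
Proof. by move=> xy; apply/val_inj/funext. Qed.

Lemma dact1 x : dact 1%g x = x.
Proof. by apply: dualP => v /=; rewrite invg1 act1. Qed.

Lemma dactM g h x : dact (g * h)%g x = dact g (dact h x).
Proof. by apply: dualP => v /=; rewrite invgM actM. Qed.

Definition cox_sd (w : W) : semidirect S := Semidirect w 1%g.

Definition pos_roots : set V :=
  [set r | (exists w s, r = act (cox_sd w) (simple_root s)) /\ forall s, 0 <= r@_s].

Definition C_Pi : set V^* :=
  [set x | (forall s, 0 <= (x (simple_root s) : R)) /\
           finite_set [set r | pos_roots r /\ ~ (0 < (x r : R))]].

Definition X_Pi : set V^* := \bigcup_w (dact (cox_sd w) @` C_Pi).

(* g acts on the subspace U as the reflection x |-> x - alpha(x) a.  Linear
   forms on U are represented by their extensions to the whole dual space. *)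
Definition acts_as_reflection (U : set V^*) (g : semidirect S)
    (alpha : {scalar V^*}) : Prop :=
  exists2 a : V^*, U a /\ (alpha a : R) = 2 &
    forall x, U x -> dact g x = x - (alpha x : R) *: a.

Context (GPi : subgroup (diagram_aut S)) (J : set Pi).
Context (GJ RJ : subgroup (sub_aut J)).

Definition fixed_dual : set V^* :=
  [set x | forall w, parabolic J w -> dact (cox_sd w) x = x].

Definition acts_on_J_as (g : semidirect S) (f : sub_aut J) : Prop :=
  forall j : J, act g (simple_root (val j)) = simple_root (val (aut_fun f j)).

Definition W'J : set (semidirect S) :=
  [set g | sd_aut g \in sg_set GPi /\
           exists2 f, f \in sg_set GJ & acts_on_J_as g f].

Definition W_Omega : set (semidirect S) :=
  generated [set g | [/\ range cox_sd g, W'J g,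
    exists alpha, acts_as_reflection fixed_dual g alpha &
    exists2 f, f \in sg_set RJ & acts_on_J_as g f]].

(* The reflection hyperplane is the kernel of alpha in fixed_dual; y and c are
   strictly separated by it when alpha y and alpha c have opposite signs. *)
Definition C_Omega : set V^* :=
  [set y | [/\ X_Pi y, fixed_dual y &
    forall g alpha, W_Omega g -> acts_as_reflection fixed_dual g alpha ->
    forall c, C_Pi c -> fixed_dual c -> ~ ((alpha c : R) * (alpha y : R) < 0)]].

Lemma acts_on_J1 : acts_on_J_as 1%g 1%g.
Proof. by move=> j; rewrite act1. Qed.

Lemma acts_on_JM g h f k : acts_on_J_as g f -> acts_on_J_as h k ->
  acts_on_J_as (g * h)%g (f * k)%g.
Proof. by move=> gf hk j; rewrite actM hk gf. Qed.

Lemma acts_on_JV g f : acts_on_J_as g f -> acts_on_J_as g^-1%g f^-1%g.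
Proof.
move=> gf j; apply: (can_inj (actK g)).
rewrite -actM mulgV act1 gf.
by have -> : aut_fun f (aut_fun f^-1%g j) = j by exact: (bij_invK (val f) j).
Qed.

Lemma acts_on_J_inj g f k : acts_on_J_as g f -> acts_on_J_as g k -> f = k.
Proof.
move=> gf gk; apply/val_inj/bijP => j; apply/val_inj/(@root_inj R).
by rewrite -[LHS]gf -[RHS]gk.
Qed.

Definition Gamma_Omega_set : set (semidirect S) :=
  [set g | W'J g /\ dact g @` C_Omega = C_Omega].

Lemma Gamma_Omega1 : 1%g \in Gamma_Omega_set.
Proof.
rewrite inE; split; last first.
  by apply/seteqP; split => [_ [x Cx <-]|x Cx]; [|exists x]; rewrite ?dact1.
by split; [exact: sg_set1|exists 1%g; [exact: sg_set1|exact: acts_on_J1]].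
Qed.

Lemma Gamma_OmegaM g h : g \in Gamma_Omega_set -> h \in Gamma_Omega_set ->
  (g * h)%g \in Gamma_Omega_set.
Proof.
rewrite !inE => -[[gP [f fJ gf]] gC] [[hP [k kJ hk]] hC]; split.
  split; first exact: sg_setM.
  by exists (f * k)%g; [exact: sg_setM|exact: acts_on_JM].
rewrite -[RHS]gC -[X in _ = _ @` X]hC image_comp; congr (_ @` _).
by apply/funext => x; exact: dactM.
Qed.

Lemma Gamma_OmegaV g : g \in Gamma_Omega_set -> (g^-1)%g \in Gamma_Omega_set.
Proof.
rewrite !inE => -[[gP [f fJ gf]] gC]; split.
  split; first exact: sg_setV.
  by exists (f^-1)%g; [exact: sg_setV|exact: acts_on_JV].
rewrite -[X in _ @` X]gC image_comp -[RHS]image_id; congr (_ @` _).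
by apply/funext => x /=; rewrite -dactM mulVg dact1.
Qed.

Definition Gamma_Omega : subgroup (semidirect S) :=
  Subgroup Gamma_Omega1 Gamma_OmegaM Gamma_OmegaV.

Lemma Gamma_Omega_sub (g : sg_type Gamma_Omega) : W'J (val g).
Proof. by have := valP g; rewrite inE => -[]. Qed.

Definition act_on_J (g : sg_type Gamma_Omega) : sg_type GJ :=
  let h := cid2 (Gamma_Omega_sub g).2 in SgElt (s2valP h).

Lemma act_on_JP g : acts_on_J_as (val g) (val (act_on_J g)).
Proof. by rewrite /act_on_J; case: cid2. Qed.

Definition natural_map (g : sg_type Gamma_Omega) : sg_type GJ * sg_type GPi :=
  (act_on_J g, SgElt (Gamma_Omega_sub g).1).

Lemma natural_map1 : natural_map 1%g = 1%g.
Proof.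
have h : acts_on_J_as 1%g (val (act_on_J 1%g)) := act_on_JP 1%g.
by congr (_, _); apply: val_inj => //; exact: (acts_on_J_inj h acts_on_J1).
Qed.

Lemma natural_mapM : {morph natural_map : g h / (g * h)%g}.
Proof.
move=> g h.
have gh : acts_on_J_as (val g * val h)%g (val (act_on_J (g * h)%g)) :=
  act_on_JP (g * h)%g.
have := acts_on_J_inj gh (acts_on_JM (act_on_JP g) (act_on_JP h)) => e.
by congr (_, _); apply: val_inj => //; exact: e.
Qed.

HB.instance Definition _ :=
  isUMagmaMorphism.Build (sg_type Gamma_Omega) (sg_type GJ * sg_type GPi)%type
    natural_map (natural_map1, natural_mapM).

End GammaOmega.

Arguments natural_map R {S} GPi {J} GJ RJ g.

Record gmodule (K : groupType) := GModule {
  gm_sort :> zmodType;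
  gm_act : K -> gm_sort -> gm_sort;
  gm_act1 : forall x, gm_act 1%g x = x;
  gm_actM : forall g h x, gm_act (g * h)%g x = gm_act g (gm_act h x);
  gm_actD : forall g x y, gm_act g (x + y) = gm_act g x + gm_act g y }.

Section Cohomology.
Context (K : groupType) (M : gmodule K).

(* Homogeneous n-cochains are the equivariant maps K^(n+1) -> M. *)
Definition cochain (n : nat) := ('I_n.+1 -> K) -> M.

Definition equivariant (n : nat) (f : cochain n) : Prop :=
  forall g x, f (fun i => (g * x i)%g) = gm_act g (f x).

Definition coboundary (n : nat) (f : cochain n) : cochain n.+1 :=
  fun x => \sum_(i < n.+2) f (x \o lift i) *~ (-1) ^+ i.

(* The vanishing of H^(n+1)(K, M). *)
Definition cohomology_vanishes (n : nat) : Prop :=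
  forall f : cochain n.+1, equivariant f -> (forall x, coboundary f x = 0) ->
  exists2 h : cochain n, equivariant h & forall x, f x = coboundary h x.

End Cohomology.

(* cd K <= d: the groups H^i(K, M) vanish for all i > d and all K-modules M. *)
Definition cohomological_dimension_le (K : groupType) (d : nat) : Prop :=
  forall (M : gmodule K) n, (d <= n)%N -> cohomology_vanishes M n.

Definition finite_cohomological_dimension (K : groupType) : Prop :=
  exists d, cohomological_dimension_le K d.

(* Main.v *)
From HB Require Import structures.
Require Import Defs.
From mathcomp Require Import all_boot all_order all_algebra.
From mathcomp Require Import finmap boolp classical_sets functions cardinality reals.
From mathcomp Require Import trigo monalg ring lra.

(* An element of the kernel is an element g of W_Pi fixing every e_j, j in J, and
   preserving the positivity of the roots orthogonal to J: apply the reflection in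
   such a root, which belongs to W_Omega, to a generic point of the face of the
   fundamental chamber fixed by W_J and to its image under g.
   Such g act by left multiplication on the set E of those w for which every
   w^-1 e_j is simple and w^-1 preserves the positivity of the roots orthogonal to J.
   Consider the cosets w W_K with w in E and K of finite type containing
   J_w = {t | w e_t in J}. The complex of tuples of cosets having a common point in E
   is acyclic: order tuples by the length of the shortest element w of their
   intersection; cone a tuple off to w W_D, where D consists of J_w and of the
   descents of w. Removing an entry either keeps w or gives a shorter element, and so
   does its coned version because D contains all descents.
   Every t in D \ J_w is adjacent to J_w, since otherwise -w e_t would be a positive
   root orthogonal to J made negative by w^-1. A node of a finite type diagram has at
   most 4 neighbours (3, in fact), so we may restrict to |K| <= 5 |J|. Sending a tuple
   to the flags of intersections of its subtuples then factors, up to an equivariant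
   homotopy, the bar resolution through a complex of dimension at most 5 |J|. The
   action on cosets is free: an element of a finite type W_K that fixes J and
   preserves the positive roots orthogonal to J preserves a positive system of the
   root system of W_K. *)

Set Implicit Arguments.
Unset Strict Implicit.
Unset Printing Implicit Defensive.

Import Order.TTheory GRing.Theory Num.Theory.

Local Open Scope ring_scope.

(** * Ordered chains *)

(* Augmented ordered chains on X: the simplex [:: x_0; ...; x_n] sits in degree n
   and [::] generates degree -1. *)
Definition chain (X : choiceType) : zmodType := {malg int[seq X]}.

(* Locked, because failing conversion tests between chains would otherwise unfold
   down to finite maps and practically diverge. *)
HB.lock Definition simplex (X : choiceType) (s : seq X) : chain X := << s >>.

(** The additive extension of [h] to the free abelian group on sequences. *)
HB.lock Definition ext (X : choiceType) (M : zmodType) (h : seq X -> M) (c : chain X) : M :=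
  \sum_(s <- msupp c) h s *~ mcoeff s c.

Section FreeAbelian.
Context (X : choiceType).
Implicit Types (P : seq X -> Prop) (c : chain X) (s : seq X).

Definition csupp P c := forall s, s \in msupp c -> P s.

Lemma csupp0 P : csupp P 0.
Proof. by move=> s; rewrite msupp0 inE. Qed.

Lemma csuppB P a b : csupp P a -> csupp P b -> csupp P (a - b).
Proof.
move=> aP bP k /(fsubsetP (msuppB_le a b)); rewrite inE => /orP[]; [exact: aP|exact: bP].
Qed.

Lemma csuppN P a : csupp P a -> csupp P (- a).
Proof. by move=> aP s; rewrite (@msuppN (seq X) int a); exact: aP. Qed.

Lemma csuppD P a b : csupp P a -> csupp P b -> csupp P (a + b).
Proof. by move=> aP bP; rewrite -[b]opprK; apply: csuppB => //; exact: csuppN. Qed.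

Lemma csuppU P s : P s -> csupp P (simplex s).
Proof. by move=> Ps t; rewrite simplex.unlock msuppU oner_eq0 inE => /eqP ->. Qed.

Lemma csupp_sub P Q c : (forall s, P s -> Q s) -> csupp P c -> csupp Q c.
Proof. by move=> PQ cP s /cP/PQ. Qed.

(** The chains supported on [P] form the subgroup generated by the simplices in [P]. Additive
    identities are therefore checked on simplices, closure under differences being the only other
    obligation. *)
Lemma csupp_ind P (Q : chain X -> Prop) :
  Q 0 -> (forall a b, Q a -> Q b -> Q (a - b)) ->
  (forall s, P s -> Q (simplex s)) -> forall c, csupp P c -> Q c.
Proof.
move=> Q0 QB QU c cP.
have QN a : Q a -> Q (- a) by rewrite -sub0r; exact: QB.
have QD a b : Q a -> Q b -> Q (a + b) by move=> Qa /QN; rewrite -[b in _ + b]opprK; exact: QB.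
have Qn a n : Q a -> Q (a *+ n).
  by move=> Qa; elim: n => [|n IH]; rewrite ?mulr0n// mulrS; exact: QD.
have Qz a (z : int) : Q a -> Q (a *~ z).
  by case: z => n Qa; rewrite ?NegzE ?mulrNz -?pmulrn; [|apply: QN]; exact: Qn.
rewrite (monalgE c) big_seq; elim/big_ind: _ => // s sc.
rewrite simplex.unlock in QU.
suff -> : << c@_s *g s >> = << s >> *~ c@_s :> chain X by exact/Qz/QU/cP.
apply/malgP => i; have E (z : int) : << z *g s >>@_i = z *+ (s == i) by exact: mcoeffU.
rewrite (raddfMz (mcoeff i)) /= !E; case: eqP => _.
  by rewrite !mulr1n intz.
by rewrite !mulr0n mul0rz.
Qed.

Lemma chain_ind (Q : chain X -> Prop) :
  Q 0 -> (forall a b, Q a -> Q b -> Q (a - b)) -> (forall s, Q (simplex s)) ->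
  forall c, Q c.
Proof. by move=> Q0 QB QU c; apply: (@csupp_ind xpredT) => // k _; exact: QU. Qed.

Section Ext.
Context (M : zmodType) (h : seq X -> M).

Lemma ext_sub (d : {fset seq X}) c : (msupp c `<=` d)%fset ->
  ext h c = \sum_(s <- d) h s *~ mcoeff s c.
Proof.
move=> cd; rewrite ext.unlock [LHS](big_fset_incl _ cd) => //= x _ /mcoeff_outdom ->.
by rewrite mulr0z.
Qed.

Lemma extB : {morph ext h : a b / a - b}.
Proof.
move=> a b; set d := (msupp a `|` msupp b)%fset.
rewrite (@ext_sub d a) ?fsubsetUl// (@ext_sub d b) ?fsubsetUr//.
rewrite (@ext_sub d (a - b)) ?(msuppB_le a b)// -sumrB.
by apply: eq_bigr => k _; rewrite (mcoeffB k a b) mulrzBr.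
Qed.

Lemma ext0 : ext h 0 = 0.
Proof. by rewrite -[X in ext _ X](subrr 0) extB subrr. Qed.

Lemma extU s : ext h (simplex s) = h s.
Proof. by rewrite simplex.unlock (ext_sub msuppU_le) big_seq_fset1 mcoeffUU. Qed.

End Ext.

Lemma eq_ext (M : zmodType) P (f g : seq X -> M) c :
  csupp P c -> (forall s, P s -> f s = g s) -> ext f c = ext g c.
Proof.
move=> cP fg; elim/csupp_ind: cP => [|a b aE bE|s /fg]; rewrite ?ext0 ?extU//.
by rewrite !extB aE bE.
Qed.

Lemma eq_extT (M : zmodType) (f g : seq X -> M) c : f =1 g -> ext f c = ext g c.
Proof. by move=> fg; apply: (@eq_ext _ xpredT) => // s _; exact: fg. Qed.

End FreeAbelian.

Lemma csupp_ext (X Y : choiceType) (P : seq X -> Prop) (Q : seq Y -> Prop)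
    (f : seq X -> chain Y) c :
  csupp P c -> (forall s, P s -> csupp Q (f s)) -> csupp Q (ext f c).
Proof.
move=> cP fQ; elim/csupp_ind: cP => [|a b aQ bQ|s /fQ]; rewrite ?ext0 ?extU//.
  exact: csupp0.
by rewrite extB; exact: csuppB.
Qed.

Lemma ext_comp (X Y : choiceType) (M : zmodType) (f : seq X -> chain Y) (g : seq Y -> M) c :
  ext g (ext f c) = ext (fun s => ext g (f s)) c.
Proof.
by elim/chain_ind: c => [|a b aE bE|s]; rewrite ?ext0 ?extU// !extB aE bE.
Qed.

(** * The boundary operator, and recursion along faces *)

Section Boundary.
Context (X : choiceType).
Implicit Types (s t : seq X) (c : chain X).

Definition cone x : chain X -> chain X := ext (fun s => simplex (x :: s) : chain X).

(** The alternating sum of faces in recursive form, d(x s) = s - x ds; the boundary of a single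
    point is [[::]], so the augmentation is included. *)
Fixpoint bd s : chain X := if s is x :: t then simplex t - cone x (bd t) else 0.

Lemma bd_nil : bd [::] = 0. Proof. by []. Qed.

Lemma bd_cons x s : bd (x :: s) = simplex s - cone x (bd s). Proof. by []. Qed.

Definition bdry : chain X -> chain X := ext bd.

Lemma coneB x : {morph cone x : a b / a - b}. Proof. exact: extB. Qed.

Lemma bdryB : {morph bdry : a b / a - b}. Proof. exact: extB. Qed.

Lemma cone0 x : cone x 0 = 0. Proof. exact: ext0. Qed.

Lemma bdry0 : bdry 0 = 0. Proof. exact: ext0. Qed.

Lemma bdryD : {morph bdry : a b / a + b}.
Proof. by move=> a b; rewrite -[b in LHS]opprK bdryB -[- b]sub0r bdryB bdry0 sub0r opprK. Qed.

Lemma coneU x s : cone x (simplex s) = simplex (x :: s). Proof. exact: extU. Qed.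

Lemma bdryU s : bdry (simplex s) = bd s. Proof. exact: extU. Qed.

Lemma bdry_cone x c : bdry (cone x c) = c - cone x (bdry c).
Proof.
elim/chain_ind: c => [|a b aE bE|s]; rewrite ?(cone0, bdry0) ?subr0//.
  by rewrite !(coneB, bdryB) aE bE !opprD !opprK addrACA.
by rewrite coneU !bdryU.
Qed.

Lemma bdry_bdry c : bdry (bdry c) = 0.
Proof.
elim/chain_ind: c => [|a b aE bE|s]; rewrite ?bdry0//.
  by rewrite !bdryB aE bE subr0.
rewrite bdryU; elim: s => [|x s IH]; rewrite ?bdry0//=.
by rewrite bdryB bdryU bdry_cone IH cone0 subr0 subrr.
Qed.

Definition face t s := subseq t s && (size s == (size t).+1).

Lemma csupp_cone P Q x c : csupp P c -> (forall s, P s -> Q (x :: s)) -> csupp Q (cone x c).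
Proof. by move=> cP PQ; apply: (csupp_ext cP) => s /PQ; exact: csuppU. Qed.

Lemma csupp_bd s : csupp (face^~ s) (bd s).
Proof.
elim: s => [|x s IH] /=; first exact: csupp0.
apply: csuppB; first by apply: csuppU; rewrite /face subseq_cons /=.
by apply: (csupp_cone IH) => t; rewrite /face /= eqxx eqSS.
Qed.

Lemma csupp_bd_size s : csupp (fun t => size s = (size t).+1) (bd s).
Proof. by apply: csupp_sub (@csupp_bd s) => t /andP[_ /eqP]. Qed.

Section Recursion.
Context (M : zmodType) (a0 : M) (step : seq X -> M -> M).

(** The fuel [n] is meant to be the length of [s]. The terms of [bd s] are exactly one entry
    shorter, which makes recursion through the boundary, a non-structural one, well founded. *)
Fixpoint bdrecn n s : M :=
  if n is n'.+1 then step s (ext (bdrecn n') (bd s)) else a0.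

Definition bdrec s := bdrecn (size s) s.

Lemma bdrec_nil : bdrec [::] = a0. Proof. by []. Qed.

Lemma bdrec_cons x s : bdrec (x :: s) = step (x :: s) (ext bdrec (bd (x :: s))).
Proof.
rewrite /bdrec /=; congr step; apply: eq_ext (@csupp_bd_size (x :: s)) _ => t [->].
by [].
Qed.

End Recursion.

Lemma face_ind (Q : seq X -> Prop) :
  (forall s, (forall t, face t s -> Q t) -> Q s) -> forall s, Q s.
Proof.
move=> Qs s; have [n] := ubnP (size s); elim: n s => // n IH s sn.
apply: Qs => t /andP[_ /eqP sE]; apply: IH.
by rewrite sE in sn.
Qed.

End Boundary.

Section Translate.
Context (X Y : choiceType) (f : X -> Y).

Definition tr : chain X -> chain Y := ext (fun s => simplex (map f s) : chain Y).

Lemma trB : {morph tr : a b / a - b}. Proof. exact: extB. Qed.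

Lemma tr0 : tr 0 = 0. Proof. exact: ext0. Qed.

Lemma trU s : tr (simplex s) = simplex (map f s). Proof. exact: extU. Qed.

Lemma tr_cone x c : tr (cone x c) = cone (f x) (tr c).
Proof.
elim/chain_ind: c => [|a b aE bE|s]; rewrite ?(cone0, bdry0, tr0)//.
  by rewrite !(coneB, trB) aE bE.
by rewrite !(coneU, trU).
Qed.

Lemma tr_bd s : tr (bd s) = bd (map f s).
Proof.
by elim: s => [|x s IH] /=; rewrite ?tr0// trB trU tr_cone IH.
Qed.

Lemma tr_bdry c : tr (bdry c) = bdry (tr c).
Proof.
elim/chain_ind: c => [|a b aE bE|s]; rewrite ?(cone0, bdry0, tr0)//.
  by rewrite !(bdryB, trB) aE bE.
by rewrite trU !bdryU tr_bd.
Qed.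

Lemma csupp_tr P Q c : csupp P c -> (forall s, P s -> Q (map f s)) -> csupp Q (tr c).
Proof. by move=> cP PQ; apply: (csupp_ext cP) => s /PQ; exact: csuppU. Qed.

End Translate.

Lemma tr_comp (X Y V : choiceType) (f : X -> Y) (g : Y -> V) c :
  tr g (tr f c) = tr (g \o f) c.
Proof.
rewrite /tr ext_comp; apply: eq_ext (csupp_sub (fun _ _ => I) (fun _ => id)) _ => s _.
by rewrite extU map_comp.
Qed.

Lemma eq_tr (X Y : choiceType) (P : seq X -> Prop) (f g : X -> Y) c :
  csupp P c -> (forall s, P s -> map f s = map g s) -> tr f c = tr g c.
Proof. by move=> cP fg; apply: (eq_ext cP) => s /fg ->. Qed.

Lemma tr_id (X : choiceType) (f : X -> X) c : f =1 id -> tr f c = c.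
Proof.
move=> f1; elim/chain_ind: c => [|a b aE bE|s]; rewrite ?tr0//.
  by rewrite trB aE bE.
by rewrite trU (eq_map f1) map_id.
Qed.

(** If [f] commutes with the boundary on the faces of [s], then d f(ds) = f(dds) = 0. This is the
    cycle condition at each stage of the inductive constructions of chain maps. *)
Lemma bdry_ext_bd (X Y : choiceType) (f : seq X -> chain Y) s :
  (forall t, face t s -> bdry (f t) = ext f (bd t)) -> bdry (ext f (bd s)) = 0.
Proof.
move=> fb; rewrite /bdry ext_comp (eq_ext (@csupp_bd _ s) fb).
by rewrite -ext_comp -/(bdry _) -[bd s]bdryU bdry_bdry ext0.
Qed.

Lemma subrBB (V : zmodType) (a b c d : V) : (a - b) - (c - d) = (a - c) - (b - d).
Proof. by rewrite !opprD !opprK addrACA. Qed.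

Lemma subrBB2 (V : zmodType) (a b c d e f : V) :
  (a - b) - (c - d) - (e - f) = (a - c - e) - (b - d - f).
Proof. by rewrite (subrBB a) (subrBB (a - c)). Qed.

(** * Acyclicity by coning towards an apex *)

Section Acyclicity.
Context (X : choiceType) (compat : seq X -> Prop).
Context (apex : seq X -> X) (lev : seq X -> nat).
Hypothesis apexP : forall s, compat s -> compat (apex s :: s).
Hypothesis compat_sub : forall s t, subseq t s -> compat s -> compat t.
Hypothesis levP : forall s t, compat s -> face t s ->
  apex t = apex s \/
  (lev (apex s :: t) < lev s)%N /\ (lev (apex t :: t) < lev s)%N.

Let compatn n s := compat s /\ size s = n.

Definition apex_cone : chain X -> chain X :=
  ext (fun s => simplex (apex s :: s) : chain X).

Local Notation T := apex_cone.

Lemma apex_coneB : {morph T : a b / a - b}. Proof. exact: extB. Qed.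

Lemma apex_coneU s : T (simplex s) = simplex (apex s :: s). Proof. exact: extU. Qed.

Lemma apex_cone0 : T 0 = 0. Proof. exact: ext0. Qed.

Let csupp_T n c : csupp (compatn n) c -> csupp (compatn n.+1) (T c).
Proof.
by move=> cn; apply: (csupp_ext cn) => s [/apexP sC sn]; apply: csuppU; split; rewrite //= sn.
Qed.

(* Coning towards the apex lowers the level: the faces t having the same apex as
   s contribute twice to (cone - T)(bd s), with opposite signs. *)
Let cone_sub_T n s : compatn n s ->
  csupp (fun t => compatn n t /\ (lev t < lev s)%N)
    (cone (apex s) (bd s) - T (bd s)).
Proof.
move=> [sC sn]; move: (@csupp_bd _ s); move: (bd s) => c cs.
elim/csupp_ind: cs => [|a b aE bE|t ts].
- by rewrite apex_cone0 cone0 subr0; exact: csupp0.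
- have -> : cone (apex s) (a - b) - T (a - b) =
      (cone (apex s) a - T a) - (cone (apex s) b - T b).
    rewrite apex_coneB coneB; exact: subrBB.
  exact: csuppB.
rewrite coneU apex_coneU.
case: (levP sC ts) => [->|[l1 l2]]; first by rewrite subrr; exact: csupp0.
have /andP[tsub /eqP st] := ts.
have tC := compat_sub tsub sC.
have asC : compat (apex s :: t).
  by apply: compat_sub (apexP sC); rewrite /= eqxx.
apply: csuppB; apply: csuppU; split=> //; split=> //=.
- by rewrite -st.
- exact: apexP.
- by rewrite -st.
Qed.

(** Subtracting from a cycle the boundary of its apex cone gives a homologous cycle of lower level.
    A chain has finitely many terms, so the levels are bounded and the process ends at 0. *)
Lemma compat_acyclic n z : csupp (compatn n) z -> bdry z = 0 ->
  exists2 y, csupp (compatn n.+1) y & bdry y = z.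
Proof.
move=> zn; pose m := (\max_(s <- msupp z) lev s).+1.
have : csupp (fun s => compatn n s /\ (lev s < m)%N) z.
  by move=> s sz; split; [exact: zn|rewrite ltnS; exact: leq_bigmax_seq].
move: m => m; elim: m z {zn} => [|m IH] z zm z0.
  exists 0; first exact: csupp0.
  elim/csupp_ind: zm {z0} => [|a b aE bE|s []//]; first by rewrite bdry0.
  by rewrite -aE -bE bdry0 subr0.
pose z' := z - bdry (T z).
have z'm : csupp (fun s => compatn n s /\ (lev s < m)%N) z'.
  (* The added term [T (bdry z)] is 0 for the cycle [z]; with it the claim is additive and can be
     checked on single simplices, which need not be cycles. *)
  suff : csupp (fun s => compatn n s /\ (lev s < m)%N) (z' - T (bdry z)).
    by rewrite z0 apex_cone0 subr0.
  rewrite /z'; elim/csupp_ind: zm => [|a b aE bE|s [sn lm]].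
  - by rewrite apex_cone0 bdry0 apex_cone0 !subr0; exact: csupp0.
  - have -> : a - b - bdry (T (a - b)) - T (bdry (a - b)) =
      (a - bdry (T a) - T (bdry a)) - (b - bdry (T b) - T (bdry b)).
      rewrite !(apex_coneB, bdryB); exact: subrBB2.
    exact: csuppB.
  have -> : simplex s - bdry (T (simplex s)) - T (bdry (simplex s)) =
      cone (apex s) (bd s) - T (bd s) :> chain X.
    by rewrite apex_coneU !bdryU/= opprB addrCA subrr addr0.
  by apply: csupp_sub (cone_sub_T sn) => t [? lts]; split=> //; exact: leq_trans lts _.
have [|y yn yz] := IH z' z'm; first by rewrite bdryB bdry_bdry z0 subr0.
exists (y + T z).
  apply: csuppD => //; apply: csupp_T.
  by apply: csupp_sub zm => s [].
by rewrite bdryD yz subrK.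
Qed.

End Acyclicity.

(** * Subdivision of tuples into flags of caps *)

Section Subdivision.
Context (X : choiceType) (compat : seq X -> Prop).
Context (cap : seq X -> X) (rk : X -> nat).
Hypothesis compat_sub : forall s t, subseq t s -> compat s -> compat t.
Hypothesis capP : forall s t, compat s -> face t s -> t != [::] ->
  cap t = cap s \/ (rk (cap s) < rk (cap t))%N.

(* Degenerate flags are zero: this is what makes subdivisions of long simplices
   vanish, since a nondegenerate flag has strictly increasing ranks. *)
Definition ncone (x : X) : chain X -> chain X :=
  ext (fun s => if ohead s == Some x then 0 else simplex (x :: s) : chain X).

Lemma nconeB x : {morph ncone x : a b / a - b}. Proof. exact: extB. Qed.

Lemma ncone0 x : ncone x 0 = 0. Proof. exact: ext0. Qed.

Lemma nconeU x s : ncone x (simplex s) = if ohead s == Some x then 0 else simplex (x :: s).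
Proof. exact: extU. Qed.

Definition is_cap x := exists s, [/\ compat s, s != [::] & x = cap s].

Definition flag s := sorted (fun x y => rk x < rk y)%N s /\ forall x, x \in s -> is_cap x.

(** The flags over which [ncone x] gives a flag again: equality of [x] with the first entry is
    allowed, since the cone is then 0. *)
Definition flag_over x s := flag s /\
  (forall y, ohead s = Some y -> x = y \/ (rk x < rk y)%N).

Lemma ncone_path x t c :
  csupp (fun s => forall y, y \in s -> y \in t) c -> all (fun y => rk x < rk y)%N t ->
  ncone x c = cone x c.
Proof.
move=> cs /allP xt; elim/csupp_ind: cs => [|a b aE bE|s st].
- by rewrite ncone0 cone0.
- by rewrite nconeB coneB aE bE.
rewrite nconeU coneU; case: s st => //= y s /(_ y (mem_head _ _))/xt xy.
by case: eqP => // -[yx]; rewrite yx ltnn in xy.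
Qed.

(** The cone formula survives the normalisation. If [s] already begins with [x], its cone is 0, and
    the right side cancels: removing that first [x] and coning restores [s], and all other faces
    begin with [x]. *)
Lemma bdry_ncone x c : csupp (flag_over x) c ->
  bdry (ncone x c) = c - ncone x (bdry c).
Proof.
have trk : transitive (fun y z => rk y < rk z)%N by move=> y w z; exact: ltn_trans.
have sub (s : seq X) : csupp (fun t => forall y, y \in t -> y \in s) (bd s).
  by apply: csupp_sub (@csupp_bd _ s) => t /andP[/mem_subseq].
move=> cx; elim/csupp_ind: cx => [|a b aE bE|s [[srt _] hd]].
- by rewrite ncone0 bdry0 ncone0 oppr0 addr0.
- by rewrite !(nconeB, bdryB) aE bE [LHS]subrBB.
rewrite nconeU bdryU.
case: s srt hd => [|y s] /= srt hd.
  by rewrite bdryU bd_cons bd_nil cone0 ncone0 !subr0.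
move: srt; rewrite (path_sortedE trk) => /andP[ys _].
have [yx|/eqP yx] := eqVneq.
  case: yx => yx; subst y.
  rewrite bdry0 nconeB -(ncone_path (sub s) ys) nconeU.
  have -> : (ohead s == Some x) = false.
    case: s ys {hd} => //= z s /andP[xz _]; apply/eqP => -[zx].
    by rewrite zx ltnn in xz.
  suff -> : ncone x (ncone x (bd s)) = 0 by rewrite subr0 subrr.
  elim/chain_ind: (bd s) => [|a b aE bE|t].
  - by rewrite !ncone0.
  - by rewrite !nconeB aE bE subr0.
  rewrite nconeU; case: ifP => _; first by rewrite ncone0.
  by rewrite nconeU /= eqxx.
have xy : (rk x < rk y)%N by case: (hd y erefl) => // xy; case: yx; rewrite xy.
have ysP : csupp (fun t => forall z, z \in t -> z \in y :: s) (bd (y :: s)).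
  by apply: csupp_sub (@csupp_bd _ (y :: s)) => t /andP[/mem_subseq].
have xys : all (fun z => rk x < rk z)%N (y :: s).
  by rewrite /= xy; apply: sub_all ys => z; exact: ltn_trans.
by rewrite bdryU (ncone_path ysP xys).
Qed.

(** Barycentric subdivision, with the cap of a subtuple in the place of its barycentre. *)
Definition sd : seq X -> chain X :=
  bdrec (simplex [::]) (fun s => ncone (cap s)).

Lemma sd_nil : sd [::] = simplex [::]. Proof. exact: bdrec_nil. Qed.

Lemma sd_cons x s : sd (x :: s) = ncone (cap (x :: s)) (ext sd (bd (x :: s))).
Proof. exact: bdrec_cons. Qed.

(** The head of each flag is recorded because the next cone needs it: by [capP] the head for a face
    has either the new cap or a larger rank. *)
Lemma sd_flag s : compat s ->
  csupp (fun t => [/\ flag t, size t = size s & s != [::] -> ohead t = Some (cap s)])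
    (sd s).
Proof.
elim/face_ind: s => -[|x s] IH sC; first by rewrite sd_nil; apply: csuppU; split.
have s0 : x :: s != [::] by [].
rewrite sd_cons; move: (x :: s) s0 IH sC => {x}s s0 IH sC.
pose Q t := flag_over (cap s) t /\ size s = (size t).+1.
have : csupp Q (ext sd (bd s)).
  apply: (csupp_ext (@csupp_bd _ s)) => t ts; have /andP[tsub /eqP st] := ts.
  apply: csupp_sub (IH t ts (compat_sub tsub sC)) => u [uF ut uhd].
  split; last by rewrite ut.
  split=> // y uy; case: (eqVneq t [::]) => [t0|t0].
    by move: ut uy; rewrite t0; case: u {uF uhd}.
  move: uy; rewrite uhd// => -[<-]; case: (capP sC ts t0) => [->|]; [left|right] => //.
move=> cQ; apply: (csupp_ext cQ) => t [[[srt tc] hd] st].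
case: (ohead t =P Some (cap s)) => hds; first exact: csupp0.
apply: csuppU; split; rewrite //= ?st//.
split.
  case: t srt hd hds {tc st} => //= y t -> hd hds; rewrite andbT.
  by case: (hd y erefl) => // yE; case: hds; rewrite -yE.
by move=> y; rewrite inE => /orP[/eqP ->|/tc//]; exists s.
Qed.

Lemma bdry_sd s : compat s -> bdry (sd s) = ext sd (bd s).
Proof.
elim/face_ind: s => -[|x s] IH sC; first by rewrite sd_nil bdryU bd_nil ext0.
have s0 : (x :: s) != [::] by [].
rewrite sd_cons bdry_ncone; last first.
  move: (x :: s) sC s0 => {IH} {}s sC s0.
  apply: (csupp_ext (@csupp_bd _ s)) => t ts; have /andP[tsub /eqP st] := ts.
  apply: csupp_sub (sd_flag (compat_sub tsub sC)) => u [uF ut uhd].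
  split=> // y uy; case: (eqVneq t [::]) => [t0|t0].
    by move: ut uy; rewrite t0; case: u {uF uhd}.
  by move: uy; rewrite uhd// => -[<-]; case: (capP sC ts t0) => [->|]; [left|right].
rewrite bdry_ext_bd ?ncone0 ?subr0// => t ts; have /andP[tsub _] := ts.
exact: IH ts (compat_sub tsub sC).
Qed.

(** A flag has strictly increasing ranks between 0 and [n], hence at most n + 1 entries. *)
Lemma sd_eq0 n s : compat s -> (forall x, is_cap x -> (rk x <= n)%N) ->
  (n.+1 < size s)%N -> sd s = 0.
Proof.
move=> sC rn ns; suff : csupp (fun=> False) (sd s).
  by elim/csupp_ind => // a b -> ->; rewrite subr0.
apply: csupp_sub (sd_flag sC) => t [[srt tc] st _].
have : sorted ltn (map rk t) by rewrite sorted_map.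
move=> /(sorted_uniq ltn_trans ltnn) ut.
have /(uniq_leq_size ut) : {subset map rk t <= iota 0 n.+1}.
  by move=> _ /mapP[x /tc/rn xn ->]; rewrite mem_iota /= add0n ltnS.
by rewrite size_map size_iota st leqNgt ns.
Qed.

End Subdivision.

Lemma ext_tr (X Y : choiceType) (M : zmodType) (f : X -> Y) (g : seq Y -> M) c :
  ext g (tr f c) = ext (fun s => g (map f s)) c.
Proof. by rewrite /tr ext_comp; apply: eq_extT => s; rewrite extU. Qed.

Lemma ext_trr (X Y V : choiceType) (f : seq X -> chain Y) (g : Y -> V) c :
  ext (fun s => tr g (f s)) c = tr g (ext f c).
Proof. by rewrite /tr ext_comp. Qed.

(** * Cochain arguments as sequences *)

Definition tolist (K : Type) (n : nat) (x : 'I_n -> K) : seq K :=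
  [seq x i | i <- enum 'I_n].

Lemma tolistS (K : Type) (n : nat) (x : 'I_n.+1 -> K) :
  tolist x = x ord0 :: tolist (x \o lift ord0).
Proof. by rewrite /tolist enum_ordSl /= -map_comp. Qed.

Lemma size_tolist (K : Type) (n : nat) (x : 'I_n -> K) : size (tolist x) = n.
Proof. by rewrite size_map size_enum_ord. Qed.

Lemma nth_tolist (K : Type) (n : nat) (x0 : K) (x : 'I_n -> K) (i : 'I_n) :
  nth x0 (tolist x) i = x i.
Proof. by rewrite /tolist (nth_map i) ?size_enum_ord// nth_ord_enum. Qed.

Lemma tolist_nth (K : Type) (x0 : K) (l : seq K) n : size l = n ->
  tolist (fun i : 'I_n => nth x0 l i) = l.
Proof.
move=> ln; apply: (@eq_from_nth _ x0); rewrite size_tolist// => i iN.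
exact: (@nth_tolist _ _ _ (fun i : 'I_n => nth x0 l i) (Ordinal iN)).
Qed.

(** Translates the recursive boundary into the sum over omitted indices that defines
    [coboundary]. *)
Lemma ext_bd_tolist (K : choiceType) (M : zmodType) (n : nat) (F : seq K -> M)
    (x : 'I_n.+1 -> K) :
  ext F (bd (tolist x)) = \sum_(i < n.+1) F (tolist (x \o lift i)) *~ (-1) ^+ i.
Proof.
elim: n F x => [|n IH] F x.
  rewrite tolistS big_ord_recl big_ord0 addr0 expr0.
  have -> (y : 'I_0 -> K) : tolist y = [::] by apply: size0nil; rewrite size_tolist.
  by rewrite bd_cons bd_nil cone0 subr0 extU.
rewrite tolistS bd_cons extB extU big_ord_recl expr0; congr (_ + _).
rewrite /cone ext_comp (eq_extT (g := fun s => F (x ord0 :: s))); last first.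
  by move=> s; rewrite extU.
rewrite IH -sumrN; apply: eq_bigr => i _; rewrite lift0 exprS mulN1r mulrNz.
congr (- (_ *~ _)); rewrite [in RHS]tolistS; congr (F (_ :: _)).
  by congr x; apply: val_inj.
apply: eq_map => j; congr x; apply: val_inj => /=.
by rewrite /bump !leq0n !add1n ltnS addnS.
Qed.

Definition lmul (K : groupType) (g h : K) : K := (g * h)%g.

(** * A bound on the cohomological dimension from an action on an acyclic complex *)

Section CohomologicalDimension.
Context (K : groupType) (X : choiceType) (act : K -> X -> X).
Context (compat : seq X -> Prop) (apex : seq X -> X) (lev : seq X -> nat).
Context (cap : seq X -> X) (rk : X -> nat) (vert : X -> K) (N : nat).
Hypothesis act1 : forall x, act 1%g x = x.
Hypothesis actM : forall g h x, act (g * h)%g x = act g (act h x).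
Hypothesis compat_nil : compat [::].
Hypothesis compat_sub : forall s t, subseq t s -> compat s -> compat t.
Hypothesis compat_act : forall g s, compat s -> compat (map (act g) s).
Hypothesis apexP : forall s, compat s -> compat (apex s :: s).
Hypothesis levP : forall s t, compat s -> face t s ->
  apex t = apex s \/
  (lev (apex s :: t) < lev s)%N /\ (lev (apex t :: t) < lev s)%N.
Hypothesis capP : forall s t, compat s -> face t s -> t != [::] ->
  cap t = cap s \/ (rk (cap s) < rk (cap t))%N.
Hypothesis cap_act : forall g s, s != [::] -> cap (map (act g) s) = act g (cap s).
Hypothesis rk_le : forall x, is_cap compat cap x -> (rk x <= N)%N.
Hypothesis vert_act : forall g x, is_cap compat cap x -> vert (act g x) = (g * vert x)%g.

Let compatn n s := compat s /\ size s = n.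

Let tract g := @tr X X (act g).
Let trmul g := @tr K K (lmul g).

Let tractM g h c : tract g (tract h c) = tract (g * h)%g c.
Proof.
rewrite /tract tr_comp; apply: (@eq_tr _ _ xpredT) => // s _.
by apply: eq_map => x; rewrite /= actM.
Qed.

Let tract1 c : tract 1%g c = c. Proof. exact: tr_id. Qed.

Let csupp_tract n g c : csupp (compatn n) c -> csupp (compatn n) (tract g c).
Proof.
move=> cn; apply: (csupp_tr cn) => s [/(@compat_act g) ? <-].
by split; rewrite ?size_map.
Qed.

Let bdry_tract g c : bdry (tract g c) = tract g (bdry c).
Proof. exact/esym/tr_bdry. Qed.

Let tract0 g : tract g 0 = 0. Proof. exact: tr0. Qed.

Let act_inj g : injective (act g).
Proof. by move=> x y xy; rewrite -[x]act1 -[y]act1 -(mulVg g) !actM xy. Qed.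

(** An arbitrary choice, not expected to commute with the action; the default 0 is taken when [z]
    bounds nothing of the right kind. *)
Definition fill n z : chain X :=
  if pselect (exists2 y, csupp (compatn n.+1) y & bdry y = z) is left h
  then s2val (cid2 h) else 0.

Lemma fillP n z : csupp (compatn n) z -> bdry z = 0 ->
  csupp (compatn n.+1) (fill n z) /\ bdry (fill n z) = z.
Proof.
move=> zn z0; rewrite /fill; case: pselect => [h|[]]; first by case: (cid2 h).
exact: (compat_acyclic apexP compat_sub levP).
Qed.

(** A chain map from the bar complex to the compatible tuples. The boundary is translated so that
    the first entry becomes 1 before it is filled; this makes the arbitrary choices of [fill]
    equivariant. *)
Definition spread : seq K -> chain X := bdrec (simplex [::])
  (fun s c => if s is g :: t then tract g (fill (size t) (tract g^-1%g c)) else 0).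

Lemma spread_cons g s : spread (g :: s) =
  tract g (fill (size s) (tract g^-1%g (ext spread (bd (g :: s))))).
Proof. exact: bdrec_cons. Qed.

Lemma spreadP s :
  csupp (compatn (size s)) (spread s) /\ bdry (spread s) = ext spread (bd s).
Proof.
elim/face_ind: s => -[_|g s IH].
  by rewrite /spread bdrec_nil bdryU bd_nil ext0; split => //; exact: csuppU.
rewrite spread_cons; set c := ext _ _.
have cC : csupp (compatn (size s)) (tract g^-1%g c).
  apply: csupp_tract; apply: (csupp_ext (@csupp_bd _ (g :: s))) => t ts.
  by have [+ _] := IH t ts; case/andP: ts => _ /eqP[<-].
have c0 : bdry (tract g^-1%g c) = 0.
  by rewrite bdry_tract bdry_ext_bd ?tract0// => t /IH[].
have [fC fb] := fillP cC c0.
split; first exact: csupp_tract.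
by rewrite bdry_tract fb tractM mulgV tract1.
Qed.

(** Both sides hand the same chain to [fill], since translation by the inverse of [g h] undoes the
    translation by [g]. *)
Lemma spread_mul g s : spread (map (lmul g) s) = tract g (spread s).
Proof.
elim/face_ind: s => -[_|h s IH]; first by rewrite /spread bdrec_nil /tract trU.
have E : tract (lmul g h)^-1%g (ext spread (bd (map (lmul g) (h :: s)))) =
    tract h^-1%g (ext spread (bd (h :: s))).
  rewrite -tr_bd ext_tr (eq_ext (@csupp_bd _ _) IH) ext_trr.
  by rewrite -/(tract g) tractM invgM -mulgA mulVg mulg1.
rewrite map_cons spread_cons size_map -(map_cons (lmul g) h s) E.
rewrite (spread_cons h s); exact: (esym (tractM g h _)).
Qed.

Local Notation sd := (sd cap).

Lemma sd_act g s : sd (map (act g) s) = tract g (sd s).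
Proof.
elim/face_ind: s => -[_|x s IH]; first by rewrite !sd_nil /tract trU.
have E : ext sd (bd (map (act g) (x :: s))) = tract g (ext sd (bd (x :: s))).
  by rewrite -tr_bd ext_tr (eq_ext (@csupp_bd _ _) IH) ext_trr.
have xs0 : x :: s != [::] by [].
rewrite map_cons.
rewrite sd_cons.
rewrite -(map_cons (act g) x s).
rewrite sd_cons.
rewrite E.
rewrite (cap_act g xs0).
move: (cap _) (ext _ _) => y c; elim/chain_ind: c => [|a b aE bE|t].
- by rewrite ncone0 /tract !tr0 ncone0.
- by rewrite nconeB /tract !trB nconeB aE bE.
rewrite nconeU /tract trU nconeU.
have -> : (ohead (map (act g) t) == Some (act g y)) = (ohead t == Some y).
  case: t => //= z t; apply/eqP/eqP => -[]; [by move/act_inj ->|by move->].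
by case: ifP => _; rewrite ?tr0 ?trU.
Qed.

(** The bar complex is sent to itself through flags of caps; [vert] returns from caps to [K]. Since
    flags are short, this map is 0 in high degrees. *)
Definition collapse s : chain K := tr vert (ext sd (spread s)).

Let csupp_sd n s : compatn n s ->
  csupp (fun t => forall x, x \in t -> is_cap compat cap x) (sd s).
Proof.
by move=> [sC _]; apply: csupp_sub (sd_flag compat_sub capP sC) => t [[_ tc] _ _].
Qed.

Lemma collapse_nil : collapse [::] = simplex [::].
Proof. by rewrite /collapse /spread bdrec_nil extU sd_nil trU. Qed.

Lemma bdry_collapse s : bdry (collapse s) = ext collapse (bd s).
Proof.
have [sC sb] := spreadP s.
rewrite /collapse -tr_bdry ext_trr -(ext_comp spread sd) -sb; congr tr.
rewrite /bdry !ext_comp; apply: (eq_ext sC) => t [tC _].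
exact: (bdry_sd compat_sub capP).
Qed.

Lemma csupp_collapse s : csupp (fun t => size t = size s) (collapse s).
Proof.
have [sC _] := spreadP s.
apply: (@csupp_tr _ _ _ (fun t => size t = size s)); last by move=> t; rewrite size_map.
apply: (csupp_ext sC) => t [tC <-].
by apply: csupp_sub (sd_flag compat_sub capP tC) => u [].
Qed.

Lemma collapse_mul g s : collapse (map (lmul g) s) = trmul g (collapse s).
Proof.
have [sC _] := spreadP s.
rewrite /collapse spread_mul /tract ext_tr.
rewrite (eq_extT (g := fun s => tract g (sd s))); last exact: sd_act.
rewrite ext_trr /trmul !tr_comp.
apply: (@eq_tr _ _ (fun t => forall x, x \in t -> is_cap compat cap x)).
  by apply: (csupp_ext sC) => t; exact: csupp_sd.
by move=> t tc; apply/eq_in_map => x /tc xc /=; exact: vert_act.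
Qed.

Lemma collapse_eq0 s : (N.+1 < size s)%N -> collapse s = 0.
Proof.
move=> Ns; have [sC _] := spreadP s; rewrite /collapse.
rewrite (eq_ext (g := fun=> 0) sC).
  suff -> : ext (fun=> 0) (spread s) = 0 :> chain X by rewrite tr0.
  elim/chain_ind: (spread s) => [|a b aE bE|t]; rewrite ?ext0 ?extU//.
  by rewrite extB aE bE subr0.
by move=> t [tC tn]; apply: (sd_eq0 compat_sub capP tC rk_le); rewrite tn.
Qed.

(* A chain homotopy from the identity to collapse: the cone over the first entry
   is a contraction that depends equivariantly on the simplex. *)
Definition homotopy : seq K -> chain K := bdrec 0
  (fun s c => if s is g :: _ then cone g (collapse s - simplex s - c) else 0).

Lemma homotopy_cons g s : homotopy (g :: s) =
  cone g (collapse (g :: s) - simplex (g :: s) - ext homotopy (bd (g :: s))).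
Proof. exact: bdrec_cons. Qed.

Lemma bdry_homotopy s :
  bdry (homotopy s) = collapse s - simplex s - ext homotopy (bd s).
Proof.
elim/face_ind: s => -[_|g s IH].
  by rewrite /homotopy bdrec_nil bd_nil bdry0 ext0 collapse_nil subrr subr0.
rewrite homotopy_cons bdry_cone.
suff -> : bdry (collapse (g :: s) - simplex (g :: s) -
    ext homotopy (bd (g :: s))) = 0 by rewrite cone0 subr0.
rewrite !bdryB bdry_collapse bdryU /bdry ext_comp -/bdry.
rewrite (eq_ext (@csupp_bd _ (g :: s)) IH).
have E c : ext (fun t => collapse t - simplex t - ext homotopy (bd t)) c =
    ext collapse c - c - ext homotopy (bdry c).
  elim/chain_ind: c => [|a b aE bE|t]; last by rewrite !extU bdryU.
    by rewrite bdry0 !ext0 !subr0.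
  rewrite bdryB !extB aE bE; exact/esym/subrBB2.
by rewrite E -bdryU bdry_bdry ext0 subr0 subrr.
Qed.

Lemma csupp_homotopy s : csupp (fun t => size t = (size s).+1) (homotopy s).
Proof.
elim/face_ind: s => -[_|g s IH]; first by rewrite /homotopy bdrec_nil; exact: csupp0.
rewrite homotopy_cons; apply: (@csupp_cone _ (fun t => size t = (size (g :: s)))).
  apply: csuppB; first by apply: csuppB; [exact: csupp_collapse|exact: csuppU].
  apply: (csupp_ext (@csupp_bd _ (g :: s))) => t ts.
  by have := IH t ts; case/andP: ts => _ /eqP <-.
by move=> t /= ->.
Qed.

Lemma homotopy_mul g s : homotopy (map (lmul g) s) = trmul g (homotopy s).
Proof.
elim/face_ind: s => -[_|h s IH].
  by rewrite /homotopy bdrec_nil /trmul tr0.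
rewrite map_cons !homotopy_cons -map_cons collapse_mul.
rewrite -tr_bd ext_tr (eq_ext (@csupp_bd _ _) IH) /trmul ext_trr tr_cone.
by rewrite !trB trU.
Qed.

(** Evaluate the cocycle on the homotopy formula: the boundary of the homotopy contributes 0 by the
    cocycle condition, [collapse] is 0 in this degree, and what remains says that [f] is the
    coboundary of minus [f] composed with [homotopy]. *)
Theorem cohomological_dimension_bound : cohomological_dimension_le K N.
Proof.
move=> M n Nn f feq fcoc.
(* The default 1 is harmless: [F] is only evaluated on chains of sequences of length [n.+2]. *)
pose F (l : seq K) : M := f (fun i => nth 1%g l i).
have FE (x : 'I_n.+2 -> K) : F (tolist x) = f x.
  by congr f; apply/funext => i; exact: nth_tolist.
have act0 g : gm_act g (0 : M) = 0.
  by apply: (addrI (gm_act g 0)); rewrite -gm_actD !addr0.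
have actB g (a b : M) : gm_act g (a - b) = gm_act g a - gm_act g b.
  by apply/eqP; rewrite eq_sym subr_eq -gm_actD subrK.
have actF g c : csupp (fun t => size t = n.+2) c ->
    ext F (trmul g c) = gm_act g (ext F c).
  move=> cn; elim/csupp_ind: cn => [|a b aE bE|l ln].
  - by rewrite /trmul tr0 !ext0 act0.
  - by rewrite /trmul trB !extB actB -/(trmul g) aE bE.
  rewrite /trmul trU !extU /F -feq; congr f; apply/funext => i.
  by rewrite (nth_map 1%g)// ln.
have F0 c : csupp (fun t => size t = n.+3) c -> ext F (bdry c) = 0.
  move=> cn; elim/csupp_ind: cn => [|a b aE bE|l ln].
  - by rewrite bdry0 ext0.
  - by rewrite bdryB extB aE bE subr0.
  rewrite bdryU -(tolist_nth 1%g ln) ext_bd_tolist -[RHS](fcoc (fun i => nth 1%g l i)).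
  by apply: eq_bigr => i _; rewrite FE.
exists (fun x => - ext F (homotopy (tolist x))).
  move=> g x; have -> : tolist (fun i => (g * x i)%g) = map (lmul g) (tolist x).
    exact: (map_comp (lmul g) x (enum _)).
  rewrite homotopy_mul actF; last first.
    by apply: csupp_sub (@csupp_homotopy _) => t; rewrite size_tolist.
  by rewrite -sub0r -[in RHS]sub0r actB act0.
move=> x; have xn : size (tolist x) = n.+2 by rewrite size_tolist.
have Hx : ext F (bdry (homotopy (tolist x))) = 0.
  by apply: F0; apply: csupp_sub (@csupp_homotopy _) => t; rewrite xn.
rewrite -FE; move: Hx; rewrite bdry_homotopy collapse_eq0 ?xn ?ltnS// sub0r.
rewrite -opprD -sub0r extB ext0 sub0r => /eqP; rewrite oppr_eq0.
have -> (a b : chain K) : ext F (a + b) = ext F a + ext F b.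
  by rewrite -[b in LHS]opprK extB -[- b]sub0r extB ext0 sub0r opprK.
rewrite extU addr_eq0 => /eqP ->.
rewrite ext_comp ext_bd_tolist -sumrN; apply: eq_bigr => i _.
by rewrite mulNrz.
Qed.

End CohomologicalDimension.

(** * Length and roots *)

Local Open Scope classical_set_scope.

Section Length.
Context (S : coxeter_system).
Notation W := (cs_group S).
Notation Pi := (cs_index S).
Notation gen := (@cs_gen S).

Definition word (l : seq Pi) : W := foldr (fun s w => gen s * w)%g 1%g l.

Lemma word_cat l1 l2 : word (l1 ++ l2) = (word l1 * word l2)%g.
Proof. by elim: l1 => [|s l IH]; rewrite ?mul1g//= IH mulgA. Qed.

Lemma genK (s : Pi) (w : W) : (w * gen s * gen s)%g = w.
Proof. by rewrite -mulgA cs_gen_sq mulg1. Qed.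

Lemma genV (s : Pi) : ((gen s)^-1)%g = gen s.
Proof. by apply: (mulgI (gen s)); rewrite mulgV cs_gen_sq. Qed.

Lemma word_rcons l s : word (rcons l s) = (word l * gen s)%g.
Proof. by rewrite -cats1 word_cat /= mulg1. Qed.

Lemma wordV l : ((word l)^-1)%g = word (rev l).
Proof.
elim: l => [|s l IH]; first by rewrite invg1.
by rewrite rev_cons word_rcons /= invgM IH genV.
Qed.

Lemma wordP w : exists l, word l == w.
Proof.
move: w; apply: gen_ind => [|s|x y [l /eqP <-] [k /eqP <-]|x [l /eqP <-]].
- by exists [::].
- by exists [:: s]; rewrite /= mulg1.
- by exists (l ++ k); rewrite word_cat.
- by exists (rev l); rewrite wordV.
Qed.

Lemma length_ex w : exists n, `[< exists l, size l = n /\ word l = w >].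
Proof.
by have [l /eqP lw] := wordP w; exists (size l); apply/asboolP; exists l.
Qed.

Definition len (w : W) : nat := ex_minn (length_ex w).

Lemma lenP w : exists l, size l = len w /\ word l = w.
Proof. by rewrite /len; case: ex_minnP => n /asboolP. Qed.

Lemma len_word l : (len (word l) <= size l)%N.
Proof. by rewrite /len; case: ex_minnP => n _; apply; apply/asboolP; exists l. Qed.

Lemma len_mul x y : (len (x * y)%g <= len x + len y)%N.
Proof.
have [l [<- <-]] := lenP x; have [k [<- <-]] := lenP y.
by rewrite -word_cat -size_cat; exact: len_word.
Qed.

Lemma exists_descent w : w != 1%g -> exists s, (len (w * gen s)%g < len w)%N.
Proof.
have [l [<- <-]] := lenP w; case: (lastP l) => [|{}l s]; first by rewrite eqxx.
by exists s; rewrite word_rcons genK size_rcons ltnS; exact: len_word.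
Qed.

End Length.

(** * The geometric representation and the sign of a root *)

Section Roots.
Context (R : realType) (S : coxeter_system).
Notation W := (cs_group S).
Notation Pi := (cs_index S).
Notation gen := (@cs_gen S).
Notation V := (cox_V R S).
Notation e := (@simple_root R S).
Notation "w • v" := (bij_fun (@geom R S w) v) (at level 40, left associativity).

Lemma geom1 v : 1%g • v = v.
Proof. by rewrite (morph_mulg1 (@geomM R S)). Qed.

Lemma geomMv x y v : (x * y)%g • v = x • (y • v).
Proof. by rewrite geomM bijM. Qed.

Lemma geomKv w v : w^-1%g • (w • v) = v.
Proof. by rewrite -geomMv mulVg geom1. Qed.

Lemma geomVKv w v : w • (w^-1%g • v) = v.
Proof. by rewrite -geomMv mulgV geom1. Qed.

Lemma geom_inj w : injective (fun v => w • v).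
Proof. by move=> u v /= uv; rewrite -(geomKv w u) uv geomKv. Qed.

Lemma geomD w u v : w • (u + v) = w • u + w • v.
Proof. by have := geom_linear w 1 u v; rewrite !scale1r. Qed.

Lemma geom0 w : w • 0 = 0.
Proof. by apply: (addrI (w • 0)); rewrite -geomD !addr0. Qed.

Lemma geomZ w a v : w • (a *: v) = a *: (w • v).
Proof. by have := geom_linear w a v 0; rewrite geom0 !addr0. Qed.

Lemma geomN w v : w • (- v) = - (w • v).
Proof. by rewrite -scaleN1r geomZ scaleN1r. Qed.

(** The form with the usual sign, for which roots have norm 2: it is the negative of [cox_form]. *)
Definition bil (v u : V) : R := lin_ext (fun t => - cox_form v (e t) : R^o) u.

Lemma bil_e v t : bil v (e t) = - cox_form v (e t).
Proof. by rewrite /bil /simple_root lin_extU. Qed.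

Lemma bil_linr v : linear (bil v : V -> R^o).
Proof. exact: lin_ext_linear. Qed.

Lemma bil_linl u : linear (fun v => bil v u : R^o).
Proof.
move=> a x y; rewrite /bil /lin_ext scaler_sumr -big_split /=.
apply: eq_bigr => t _; rewrite cox_form_linear /GRing.scale /=; ring.
Qed.

Lemma bilDl x y u : bil (x + y) u = bil x u + bil y u.
Proof. by have := bil_linl u 1 x y; rewrite !scale1r. Qed.
Lemma bilDr x y u : bil u (x + y) = bil u x + bil u y.
Proof. by have := bil_linr u 1 x y; rewrite !scale1r. Qed.
Lemma bil0l u : bil 0 u = 0.
Proof. by apply: (addrI (bil 0 u)); rewrite -bilDl !addr0. Qed.
Lemma bil0r u : bil u 0 = 0.
Proof. by apply: (addrI (bil u 0)); rewrite -bilDr !addr0. Qed.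
Lemma bilZl a x u : bil (a *: x) u = a * bil x u.
Proof. by have := bil_linl u a x 0; rewrite bil0l !addr0. Qed.
Lemma bilZr a x u : bil u (a *: x) = a * bil u x.
Proof. by have := bil_linr u a x 0; rewrite bil0r !addr0. Qed.
Lemma bilNl x u : bil (- x) u = - bil x u.
Proof. by rewrite -scaleN1r bilZl mulN1r. Qed.
Lemma bilNr x u : bil u (- x) = - bil u x.
Proof. by rewrite -scaleN1r bilZr mulN1r. Qed.

Lemma bil_ee s t : bil (e s) (e t) = - (2 * cos (pi / (cox_m s t)%:R)).
Proof. by rewrite bil_e cox_form_root. Qed.

Lemma bil_ss s : bil (e s) (e s) = 2.
Proof. by rewrite bil_e cox_form_rootss opprK. Qed.

Lemma bilC u v : bil u v = bil v u.
Proof.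
move: u; apply: (@malg_linear_eq R Pi R^o); [exact: bil_linl|exact: bil_linr|move=> s].
move: v; apply: (@malg_linear_eq R Pi R^o); [exact: bil_linr|exact: bil_linl|move=> t].
by rewrite -!/(e _) !bil_ee cox_mC.
Qed.

Lemma geom_genE s v : gen s • v = v - bil v (e s) *: e s.
Proof. by rewrite geom_gen /= /refl bil_e scaleNr opprK. Qed.

Lemma gen_e s : gen s • e s = - e s.
Proof. by rewrite geom_genE bil_ss scaler_nat mulr2n opprD addrA subrr sub0r. Qed.

Lemma bil_geom w u v : bil (w • u) (w • v) = bil u v.
Proof.
move: w u v; apply: gen_ind => [u v|s u v|x y IHx IHy u v|x IH u v].
- by rewrite !geom1.
- rewrite !geom_genE !(bilDl, bilDr, bilNl, bilNr, bilZl, bilZr) bil_ss (bilC (e s)).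
  by ring.
- by rewrite !geomMv IHx IHy.
- by rewrite -{2}(geomVKv x u) -{2}(geomVKv x v) IH.
Qed.

Lemma bil_geoml w u v : bil (w • u) v = bil u (w^-1%g • v).
Proof. by rewrite -(bil_geom w u) geomVKv. Qed.

Definition pos (v : V) := forall s, 0 <= v@_s.

Lemma pos_e s : pos (e s).
Proof. by move=> t; rewrite mcoeffU mulrn_wge0. Qed.

Lemma mcoeff_e s t : (e s)@_t = (s == t)%:R.
Proof. exact: mcoeffU. Qed.

Lemma posD u v : pos u -> pos v -> pos (u + v).
Proof. by move=> pu pv s; rewrite mcoeffD addr_ge0. Qed.

Lemma posZ a v : 0 <= a -> pos v -> pos (a *: v).
Proof. by move=> a0 pv s; rewrite mcoeffZ mulr_ge0. Qed.

Lemma pos_anti v : pos v -> pos (- v) -> v = 0.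
Proof.
move=> p n; apply/malgP => s; rewrite mcoeff0; apply/eqP.
by rewrite eq_le p andbT; have := n s; rewrite mcoeffN oppr_ge0.
Qed.

Lemma pos_sum (I : Type) (r : seq I) (P : pred I) (F : I -> V) :
  (forall i, P i -> pos (F i)) -> pos (\sum_(i <- r | P i) F i).
Proof.
by move=> PF; elim/big_ind: _ => //; [move=> s; rewrite mcoeff0|exact: posD].
Qed.

Lemma coordE (v : V) : v = \sum_(s <- msupp v) v@_s *: e s.
Proof.
by rewrite -[RHS]/(lin_ext e v) -(@lin_ext_unique _ _ _ e id).
Qed.

(* Chebyshev coefficients: sin th * cheb n = sin (n * th) for c = 2 cos th. *)
Fixpoint cheb2 (c : R) (n : nat) : R * R :=
  if n is n'.+1 then let: (a, b) := cheb2 c n' in (b, c * b - a) else (0, 1).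

Definition cheb c n := (cheb2 c n).1.

Lemma cheb0 c : cheb c 0 = 0. Proof. by []. Qed.
Lemma cheb1 c : cheb c 1 = 1. Proof. by []. Qed.
Lemma chebS c n : cheb c n.+2 = c * cheb c n.+1 - cheb c n.
Proof. by rewrite /cheb /=; case: (cheb2 c n). Qed.

Lemma sin_cheb th n : sin th * cheb (2 * cos th) n = sin (n%:R * th).
Proof.
suff : sin th * cheb (2 * cos th) n = sin (n%:R * th) /\
    sin th * cheb (2 * cos th) n.+1 = sin (n.+1%:R * th) by case.
elim: n => [|n [IH IH']]; first by rewrite cheb0 cheb1 mul0r mulr0 sin0 mul1r mulr1.
split=> //; rewrite chebS.
have E : n.+2%:R * th = n.+1%:R * th + th by rewrite -natr1 mulrDl mul1r.
have E' : n%:R * th = n.+1%:R * th - th by rewrite -natr1 mulrDl mul1r addrK.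
have -> : sin th * (2 * cos th * cheb (2 * cos th) n.+1 - cheb (2 * cos th) n) =
  2 * cos th * (sin th * cheb (2 * cos th) n.+1) - sin th * cheb (2 * cos th) n by ring.
by rewrite IH IH' E E' sinB sinD; ring.
Qed.

Lemma cheb_id n : cheb 2 n = n%:R.
Proof.
suff : cheb 2 n = n%:R /\ cheb 2 n.+1 = n.+1%:R by case.
elim: n => [|n [IH IH']]; first by rewrite cheb0 cheb1.
split=> //; rewrite chebS IH IH' -!natr1; ring.
Qed.

Definition cox_c (s t : Pi) : R := 2 * cos (pi / (cox_m s t)%:R).

Lemma gen_order (s t : Pi) : ((gen s * gen t) ^+ cox_m s t = 1)%g.
Proof. by rewrite /cox_m /gorder; case: pselect => // h; case: ex_minnP => n /andP[_ /eqP]. Qed.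

Lemma cox_m_neq1 (s t : Pi) : s != t -> cox_m s t != 1%N.
Proof.
move=> st; apply/eqP => m1; have := gen_order s t; rewrite m1 expg1 => st1.
case/eqP: st; apply: (@cs_gen_inj S); rewrite -[RHS]mul1g -st1.
by rewrite -mulgA cs_gen_sq mulg1.
Qed.

(** For finite m put th = pi / m: then sin th > 0, and sin (n th) >= 0 as long as n <= m. For
    infinite m the value is the integer n. *)
Lemma cheb_ge0 (s t : Pi) n : s != t -> (cox_m s t = 0%N \/ (n <= cox_m s t)%N) ->
  0 <= cheb (cox_c s t) n.
Proof.
move=> st; rewrite /cox_c; set m := cox_m s t.
have m1 := cox_m_neq1 st; case: (posnP m) => [m0 _|m0 [m0'|nm]].
- by rewrite m0 invr0 mulr0 cos0 mulr1 cheb_id.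
- by rewrite m0' in m0.
have m2 : (1 < m)%N by rewrite ltn_neqAle eq_sym m1.
set th := pi / m%:R.
have th0 : 0 < th by rewrite divr_gt0 ?pi_gt0 ?ltr0n.
have thpi : th < pi by rewrite ltr_pdivrMr ?ltr0n// ltr_pMr ?pi_gt0// ltr1n.
have sth : 0 < sin th by apply: sin_gt0_pi; rewrite th0.
rewrite -(pmulr_rge0 _ sth) sin_cheb; apply: sin_ge0_pi.
rewrite mulr_ge0 ?ler0n ?(ltW th0)//=.
have -> : pi = m%:R * th :> R by rewrite /th mulrC divfK// pnatr_eq0 -lt0n.
by rewrite ler_pM2r// ler_nat.
Qed.

(* The alternating word of length k in s and t that ends in t. *)
Fixpoint alt (k : nat) (s t : Pi) : seq Pi :=
  if k is k'.+1 then rcons (alt k' t s) t else [::].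

Lemma altS k s t : alt k.+1 s t = rcons (alt k t s) t. Proof. by []. Qed.

Lemma size_alt k s t : size (alt k s t) = k.
Proof. by elim: k s t => //= k IH s t; rewrite size_rcons IH. Qed.

(** The last letter t sends e_s to e_s + c e_t, and the letter s before it sends e_s to - e_s. This
    is the recursion of [cheb]; it reaches two steps back, hence the paired induction. *)
Lemma alt_root k s t : word (alt k s t) • e s =
  (if odd k then cheb (cox_c s t) k else cheb (cox_c s t) k.+1) *: e s +
  (if odd k then cheb (cox_c s t) k.+1 else cheb (cox_c s t) k) *: e t.
Proof.
have cC x y : cox_c x y = cox_c y x by rewrite /cox_c cox_mC.
have bE x y : bil (e x) (e y) = - cox_c x y by rewrite bil_ee.
pose P k := forall s t, word (alt k s t) • e s =
  (if odd k then cheb (cox_c s t) k else cheb (cox_c s t) k.+1) *: e s +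
  (if odd k then cheb (cox_c s t) k.+1 else cheb (cox_c s t) k) *: e t.
suff : P k /\ P k.+1 by case.
elim: k {s t} => [|k [IH IH']].
  split=> s t /=.
    by rewrite geom1 cheb0 cheb1 scale0r addr0 scale1r.
  rewrite geomMv geom1 geom_genE bE chebS cheb0 cheb1 subr0 mulr1 scale1r.
  by rewrite scaleNr opprK.
split=> // s t.
have -> : word (alt k.+2 s t) • e s =
    cox_c s t *: (word (alt k.+1 t s) • e t) - word (alt k s t) • e s.
  rewrite (altS k.+1 s t) word_rcons geomMv geom_genE bE.
  rewrite scaleNr opprK geomD geomZ addrC; congr (_ + _).
  by rewrite (altS k t s) word_rcons geomMv gen_e geomN.
rewrite IH' IH (cC t s) /= !chebS.
set a := cheb _ _; set b := cheb _ _; set c := cox_c s t.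
move: (e s) (e t) => x y; apply/malgP => r.
by rewrite !(mcoeffD, mcoeffN, mcoeffZ); case: (odd k) => /=; ring.
Qed.

Lemma word_alt_double n s t : word (alt n.*2 s t) = ((gen s * gen t) ^+ n)%g.
Proof.
elim: n => [|n IH]; first by rewrite expg0.
by rewrite doubleS altS word_rcons altS word_rcons IH expgSr mulgA.
Qed.

Lemma expg_genV s t n : ((gen s * gen t) ^- n = (gen t * gen s) ^+ n)%g.
Proof. by rewrite -expVgn invgM !genV. Qed.

(** The braid relation; for infinite order both words are empty. *)
Lemma word_alt_order s t : word (alt (cox_m s t) s t) = word (alt (cox_m s t) t s).
Proof.
have := gen_order s t; move: (cox_m s t) => m.
rewrite -(odd_double_half m); case: (odd m); rewrite ?add1n ?add0n.
  rewrite !altS !word_rcons !word_alt_double => st1.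
  rewrite -expg_genV; apply: (mulgI ((gen s * gen t) ^+ m./2)%g).
  rewrite mulgA mulgV mul1g mulgA -expgnDr addnn; apply: (mulIg (gen t)).
  by rewrite cs_gen_sq -mulgA -expgSr.
rewrite !word_alt_double -addnn expgnDr => st1.
by apply: (mulgI ((gen s * gen t) ^+ m./2)%g); rewrite st1 -(expg_genV s t) mulgV.
Qed.

Lemma alt_suffix j k s t : exists2 p, size p = j & alt (j + k) s t = p ++ alt k s t.
Proof.
elim: k s t => [|k IH] s t.
  by exists (alt j s t); rewrite ?size_alt// addn0 cats0.
have [p pj pE] := IH t s; exists p => //.
by rewrite addnS !altS pE rcons_cat.
Qed.

(** Alternation could only fail by a repeated letter, and this would cancel. *)
Lemma reduced_alt s t l : all (fun r => (r == s) || (r == t)) l ->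
  (forall l', word l' = word l -> (size l <= size l')%N) ->
  l = alt (size l) s t \/ l = alt (size l) t s.
Proof.
elim/last_ind: l => [|l r IH]; first by left.
rewrite all_rcons => /andP[rst lst] red.
have lred l' : word l' = word l -> (size l <= size l')%N.
  by move=> E; have := red (rcons l' r); rewrite !word_rcons E !size_rcons; exact.
have nodup l' : l <> rcons l' r.
  move=> E; have := red l'; rewrite E !word_rcons genK !size_rcons => /(_ erefl).
  by rewrite ltnNge leqnSn.
rewrite size_rcons !altS.
have {rst} [/eqP rE|/eqP rE] := orP rst; subst r; [right|left].
  case: (IH lst lred) => lE; first by rewrite -lE.
  by case: (size l) lE => [|k] lE; [rewrite lE|case: (nodup (alt k s t))].
case: (IH lst lred) => lE; last by rewrite -lE.
by case: (size l) lE => [|k] lE; [rewrite lE|case: (nodup (alt k t s))].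
Qed.

(* Write w = v u with u in the dihedral group of s and t as long as possible: then
   v e_s and v e_t are positive by induction, and u e_s has nonnegative coefficients,
   because u is too short to be written with s as its last letter. *)
Lemma root_pos_len w s : (len w <= len (w * gen s)%g)%N -> pos (w • e s).
Proof.
have [n] := ubnP (len w); elim: n w s => // n IH w s wn wws.
have [->|w1] := eqVneq w 1%g; first by rewrite geom1; exact: pos_e.
have [t wt] := exists_descent w1.
have st : s != t by apply/eqP => st; rewrite -st ltnNge wws in wt.
(* Factorisations w = v u with additive lengths, u being a word of length [k] in s and t. *)
pose Q k := exists v l, [/\ w = (v * word l)%g, (len v + size l <= len w)%N,
  all (fun r => (r == s) || (r == t)) l & size l = k].
have Q1 : exists k, `[< Q k >].
  exists 1%N; apply/asboolP; exists (w * gen t)%g, [:: t].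
  by rewrite /= mulg1 genK addn1 eqxx orbT.
have Qle k : `[< Q k >] -> (k <= len w)%N.
  by move=> /asboolP[v [l [_ vl _ <-]]]; apply: leq_trans vl; rewrite leq_addl.
have := ex_maxnP Q1 Qle; case: ex_maxnP => k /asboolP[v [l [wE vlw lst lk]]] kmax _.
have k1 : (0 < k)%N.
  apply: kmax; apply/asboolP; exists (w * gen t)%g, [:: t].
  by rewrite /= mulg1 genK addn1 eqxx orbT.
have vr r : (r == s) || (r == t) -> pos (v • e r).
  move=> rst; apply: IH.
    move: wn; rewrite !ltnS => wn; rewrite (leq_trans _ wn)// (leq_trans _ vlw)// lk.
    by rewrite -addn1 leq_add2l.
  rewrite leqNgt; apply/negP => vrv; suff : (k.+1 <= k)%N by rewrite ltnn.
  apply: kmax; apply/asboolP; exists (v * gen r)%g, (r :: l).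
  split; rewrite /= ?rst ?lk//.
    by rewrite mulgA genK.
  by rewrite addnS -addSn -lk; apply: leq_trans vlw; rewrite leq_add2r.
(* In such a factorisation with [k] maximal, u s cannot be written with fewer than [k] letters,
   since s does not shorten w. *)
have short x m : (w * gen s)%g = (v * word x)%g -> (size x + m.+1 = k)%N -> False.
  move=> E xk; have : (len (w * gen s)%g <= len v + size x)%N.
    by rewrite E (leq_trans (len_mul _ _))// leq_add2l len_word.
  move=> /(leq_trans wws)/(leq_trans vlw).
  by rewrite leq_add2l lk -xk addnS ltnNge leq_addr.
have red l' : word l' = word l -> (size l <= size l')%N.
  move=> E; rewrite -(leq_add2l (len v)) (leq_trans vlw)//.
  by rewrite wE -E (leq_trans (len_mul _ _))// leq_add2l len_word.
have lE : l = alt k s t.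
  rewrite -lk; case: (reduced_alt lst red) => // lE; exfalso.
  case: k k1 lk lE {kmax} short => // k _ lk; rewrite lk altS => lE short.
  apply: (short (alt k s t) 0%N); last by rewrite size_alt addn1.
  by rewrite wE lE word_rcons mulgA genK.
(* Otherwise u ends in an alternating word of length m_st, and the braid relation rewrites it with s
   as its last letter. *)
have km : cox_m s t = 0%N \/ (k < cox_m s t)%N.
  case: (posnP (cox_m s t)) => [|m0]; [by left|right].
  rewrite ltnNge; apply/negP => mk.
  have [p pk pE] := alt_suffix (k - cox_m s t) (cox_m s t) s t.
  rewrite subnK// -lE in pE.
  move: pE (word_alt_order s t) (pk); case: (cox_m s t) mk m0 => // m mk _ pE.
  rewrite [alt m.+1 t s]altS word_rcons => aE pk'.
  apply: (short (p ++ alt m s t) 0%N).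
    by rewrite wE pE !word_cat aE !mulgA genK.
  by rewrite size_cat size_alt pk' addn1 -addnS subnK.
have c1 : 0 <= cheb (cox_c s t) k.
  by apply: cheb_ge0 => //; case: km => [|/ltnW]; [left|right].
have c2 : 0 <= cheb (cox_c s t) k.+1.
  exact: cheb_ge0.
rewrite wE geomMv lE alt_root geomD !geomZ.
by case: (odd k); apply: posD; apply: posZ => //; apply: vr; rewrite eqxx ?orbT.
Qed.

Lemma root_neg_len w s : (len (w * gen s)%g <= len w)%N -> pos (- (w • e s)).
Proof.
move=> ws; rewrite -geomN -gen_e -geomMv; apply: root_pos_len.
by rewrite genK.
Qed.

End Roots.

(** * Positive and negative roots, and inversions *)

Section RootSystem.
Context (R : realType) (S : coxeter_system).
Notation W := (cs_group S).
Notation Pi := (cs_index S).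
Notation gen := (@cs_gen S).
Notation V := (cox_V R S).
Notation e := (@simple_root R S).
Notation "w • v" := (bij_fun (@geom R S w) v) (at level 40, left associativity).

Definition is_root (v : V) := exists w s, v = w • e s.

Lemma root_e s : is_root (e s).
Proof. by exists 1%g, s; rewrite geom1. Qed.

Lemma root_geom w b : is_root b -> is_root (w • b).
Proof. by move=> [x [s ->]]; exists (w * x)%g, s; rewrite geomMv. Qed.

Lemma root_opp b : is_root b -> is_root (- b).
Proof. by move=> [x [s ->]]; exists (x * gen s)%g, s; rewrite geomMv gen_e geomN. Qed.

Lemma root_sign b : is_root b -> pos b \/ pos (- b).
Proof.
move=> [w [s ->]]; case: (leqP (len w) (len (w * gen s)%g)).
  by move=> /(@root_pos_len R); left.
by move=> /ltnW/(@root_neg_len R); right.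
Qed.

Lemma bil_root b : is_root b -> bil b b = 2.
Proof. by move=> [w [s ->]]; rewrite bil_geom bil_ss. Qed.

Lemma root_neq0 b : is_root b -> b <> 0.
Proof. by move=> /bil_root + b0; rewrite b0 bil0l => /esym/eqP; rewrite pnatr_eq0. Qed.

Lemma root_not_pos b : is_root b -> pos b -> pos (- b) -> False.
Proof. by move=> /root_neq0 b0 p n; exact/b0/pos_anti. Qed.

Lemma descent_len w s : pos (- (w • e s)) -> (len (w * gen s)%g < len w)%N.
Proof.
move=> n; rewrite ltnNge; apply/negP => /(@root_pos_len R) p.
by apply: root_not_pos p n; exact/root_geom/root_e.
Qed.

Lemma exists_neg w : w <> 1%g -> exists s, pos (- (w • e s)).
Proof.
by move=> /eqP /exists_descent[s /ltnW ws]; exists s; exact: root_neg_len.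
Qed.

(** Membership of [v] in the span of [K]. *)
Definition vanish (K : set Pi) (v : V) := forall t, ~ K t -> v@_t = 0.

Lemma vanish_e (K : set Pi) s : K s -> vanish K (e s).
Proof. by move=> Ks t Kt; rewrite mcoeff_e; case: eqP => // st; case: Kt; rewrite -st. Qed.

Lemma vanish_eP (K : set Pi) s : vanish K (e s) -> K s.
Proof.
by move=> v; apply: contrapT => /v; rewrite mcoeff_e eqxx => /eqP; rewrite oner_eq0.
Qed.

Lemma vanishD K u v : vanish K u -> vanish K v -> vanish K (u + v).
Proof. by move=> Ku Kv t Kt; rewrite mcoeffD Ku// Kv// addr0. Qed.

Lemma vanishZ K a v : vanish K v -> vanish K (a *: v).
Proof. by move=> Kv t Kt; rewrite mcoeffZ Kv// mulr0. Qed.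

Lemma vanishN K v : vanish K v -> vanish K (- v).
Proof. by move=> Kv t Kt; rewrite mcoeffN Kv// oppr0. Qed.

Lemma vanish_sub (K L : set Pi) v : K `<=` L -> vanish K v -> vanish L v.
Proof. by move=> KL Kv t Lt; apply: Kv => /KL. Qed.

Lemma vanish_supp K v s : vanish K v -> s \in msupp v -> K s.
Proof.
by move=> Kv sv; apply: contrapT => /Kv v0; move: sv; rewrite -mcoeff_neq0 v0 eqxx.
Qed.

Lemma geom_sum w (v : V) : w • v = \sum_(s <- msupp v) v@_s *: (w • e s).
Proof.
rewrite {1}(coordE v); elim/big_rec2: _ => [|s x y _ <-]; first exact: geom0.
by rewrite geomD geomZ.
Qed.

Lemma pos_geom w (K : set Pi) v : (forall t, K t -> pos (w • e t)) ->
  pos v -> vanish K v -> pos (w • v).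
Proof.
move=> wK pv Kv; rewrite geom_sum big_seq; apply: pos_sum => s sv.
by apply: posZ; [exact: pv|apply/wK/(vanish_supp Kv)].
Qed.

(** Norm 2 forces the one remaining coefficient to be 1 or -1. *)
Lemma root_single b s : is_root b -> pos b -> (forall t, t != s -> b@_t = 0) -> b = e s.
Proof.
move=> rb pb b0; have bE : b = b@_s *: e s.
  apply/malgP => t; rewrite mcoeffZ mcoeff_e; case: (eqVneq s t) => [->|st]; rewrite ?mulr1//.
  by rewrite mulr0 b0// eq_sym.
have := bil_root rb; rewrite {1 2}bE bilZl bilZr bil_ss => b2.
have : b@_s ^+ 2 = 1 by apply: (@mulIf _ 2); rewrite ?pnatr_eq0// mul1r -[RHS]b2; ring.
move=> /eqP; rewrite sqrf_eq1 => /orP[/eqP b1|/eqP b1].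
  by rewrite bE b1 scale1r.
by have := pb s; rewrite b1 oppr_ge0 ler10.
Qed.

Lemma root_le_simple b s c : is_root b -> pos b -> 0 < c -> pos (e s - c *: b) -> b = e s.
Proof.
move=> rb pb c0 p; apply: root_single => // t ts; apply/eqP.
rewrite eq_le pb andbT; have := p t.
rewrite mcoeffB mcoeff_e mcoeffZ eq_sym (negbTE ts) sub0r oppr_ge0.
by rewrite pmulr_rle0.
Qed.

Lemma coef_gen s v t : t != s -> (gen s • v)@_t = v@_t.
Proof.
by move=> ts; rewrite geom_genE mcoeffB mcoeffZ mcoeff_e eq_sym (negbTE ts) mulr0 subr0.
Qed.

(** The reflection changes only the coefficient at [s]; if the image were negative, all other
    coefficients of [b] would be 0. *)
Lemma gen_pos b s : is_root b -> pos b -> b <> e s -> pos (gen s • b).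
Proof.
move=> rb pb bs; case: (root_sign (root_geom (gen s) rb)) => // n.
case: bs; apply: root_single => // t ts; apply/eqP; rewrite eq_le pb andbT.
by have := n t; rewrite mcoeffN coef_gen// oppr_ge0.
Qed.

Definition inversions w := [set b : V | [/\ is_root b, pos b & pos (- (w • b))]].

(** Appending a letter s to a word adds at most the inversion e_s and moves the others by s. *)
Lemma finite_inversions w : finite_set (inversions w).
Proof.
have [l /eqP <-] := wordP w; elim/last_ind: l => [|l s IH].
  apply: (@sub_finite_set _ _ set0); last exact: finite_set0.
  by move=> b [rb pb]; rewrite geom1; exact: root_not_pos.
apply: (@sub_finite_set _ _ ([set e s] `|` ((fun b => gen s • b) @` inversions (word l)))).
  move=> b [rb pb]; rewrite word_rcons geomMv => n.
  have [->|bs] := pselect (b = e s); [by left|right].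
  exists (gen s • b); last by rewrite -{1}(genV s) geomKv.
  by split => //; [exact: root_geom|exact: gen_pos].
by rewrite finite_setU; split; [exact: finite_set1|exact: finite_image].
Qed.

(** * Parabolic subgroups and their cosets *)

Section Parabolic.
Implicit Types (K L : set Pi) (w u x : W).

Lemma par1 K : parabolic K 1%g.
Proof. by move=> A [[A1 _ _] _]; rewrite inE in A1. Qed.

Lemma par_gen K s : K s -> parabolic K (gen s).
Proof. by move=> Ks A [_]; apply; exists s. Qed.

Lemma parM K x y : parabolic K x -> parabolic K y -> parabolic K (x * y)%g.
Proof.
move=> Kx Ky A AP; have [[_ AM _] _] := AP.
have := AM x y; rewrite !inE; apply; [exact: Kx|exact: Ky].
Qed.

Lemma parV K x : parabolic K x -> parabolic K (x^-1)%g.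
Proof.
move=> Kx A AP; have [[_ _ AV] _] := AP.
by have := AV x; rewrite !inE; apply; exact: Kx.
Qed.

Lemma par_ind K (P : W -> Prop) :
  P 1%g -> (forall s, K s -> P (gen s)) -> (forall x y, P x -> P y -> P (x * y)%g) ->
  (forall x, P x -> P (x^-1)%g) -> forall w, parabolic K w -> P w.
Proof.
move=> P1 Ps PM PV w; apply; split => [|_ [s Ks <-]]; last exact: Ps.
split; rewrite ?inE// => x; first by move=> y; rewrite !inE; exact: PM.
by rewrite !inE; exact: PV.
Qed.

Lemma par_sub K L w : K `<=` L -> parabolic K w -> parabolic L w.
Proof.
move=> KL; elim/par_ind; [exact: par1|by move=> s /KL; exact: par_gen|by move=> x y; exact: parM|].
by move=> x; exact: parV.
Qed.

Lemma par_coef K w v t : parabolic K w -> ~ K t -> (w • v)@_t = v@_t.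
Proof.
move=> Kw Kt; elim/par_ind: Kw v => [v|s Ks v|x y IHx IHy v|x IH v].
- by rewrite geom1.
- by rewrite coef_gen//; apply/eqP => ts; case: Kt; rewrite ts.
- by rewrite geomMv IHx IHy.
- by rewrite -[in RHS](geomVKv x v) IH.
Qed.

Lemma par_vanish K w v : parabolic K w -> vanish K v -> vanish K (w • v).
Proof. by move=> Kw Kv t Kt; rewrite (par_coef _ Kw)// Kv. Qed.

Lemma par_genP K s : parabolic K (gen s) -> K s.
Proof.
move=> Ks; apply: contrapT => nKs; have := par_coef (e s) Ks nKs.
rewrite gen_e mcoeffN mcoeff_e eqxx => /eqP; rewrite eq_sym -addr_eq0 -mulr2n pnatr_eq0.
by [].
Qed.

Lemma par_neg K w t : parabolic K w -> pos (- (w • e t)) -> K t.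
Proof.
move=> Kw n; apply: contrapT => Kt; have := n t.
by rewrite mcoeffN (par_coef _ Kw)// mcoeff_e eqxx oppr_ge0 ler10.
Qed.

Lemma par_descent K w : parabolic K w -> w <> 1%g ->
  exists2 t, K t & pos (- (w • e t)).
Proof. by move=> Kw /exists_neg[t n]; exists t => //; exact: par_neg n. Qed.

Lemma par_eq1 K w : parabolic K w -> (forall t, K t -> pos (w • e t)) -> w = 1%g.
Proof.
move=> Kw p; apply: contrapT => /(par_descent Kw)[t Kt n].
by apply: root_not_pos n; [exact/root_geom/root_e|exact: p].
Qed.

(** A descent of [w] lies in both [K] and [L], because [w] changes no coefficient outside either; it
    can be split off and the length decreases. *)
Lemma parI K L w : parabolic K w -> parabolic L w -> parabolic (K `&` L) w.
Proof.
have [n] := ubnP (len w); elim: n w => // n IH w wn Kw Lw.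
have [->|w1] := pselect (w = 1%g); first exact: par1.
have [t neg] := exists_neg w1.
have Kt := par_neg Kw neg; have Lt := par_neg Lw neg.
rewrite -(genK t w); apply: parM; last by apply: par_gen.
apply: IH; first by apply: leq_trans (descent_len neg) _; rewrite -ltnS.
- by apply: parM => //; exact: par_gen.
- by apply: parM => //; exact: par_gen.
Qed.

Lemma coset_min K w : exists m u, [/\ w = (m * u)%g, parabolic K u,
  forall t, K t -> pos (m • e t) & m = w \/ (len m < len w)%N].
Proof.
have [n] := ubnP (len w); elim: n w => // n IH w wn.
have [[t Kt neg]|noneg] := pselect (exists2 t, K t & pos (- (w • e t))).
  have wt := descent_len neg.
  have [|m [u [E Ku p ml]]] := IH (w * gen t)%g; first exact: leq_trans wt _.
  exists m, (u * gen t)%g; split=> //.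
  - by rewrite mulgA -E genK.
  - by apply: parM => //; exact: par_gen.
  - by right; case: ml => [->//|ml]; exact: ltn_trans ml wt.
exists w, 1%g; split; [by rewrite mulg1|exact: par1| |by left].
move=> t Kt; case: (root_sign (root_geom w (root_e t))) => // neg.
by case: noneg; exists t.
Qed.

Definition coset w K : set W := [set x | parabolic K (w^-1 * x)%g].

Lemma coset_refl w K : coset w K w.
Proof. by rewrite /coset /= mulVg; exact: par1. Qed.

Lemma coset_mul w u K : parabolic K u -> coset w K (w * u)%g.
Proof. by rewrite /coset /= mulgA mulVg mul1g. Qed.

Lemma coset_eq w x K : coset w K x -> coset x K = coset w K.
Proof.
rewrite /coset /= => Kx; apply/seteqP; split => y /= Ky.
  have -> : (w^-1 * y)%g = (w^-1 * x * (x^-1 * y))%g by rewrite -mulgA (mulgA x) mulgV mul1g.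
  exact: parM.
have -> : (x^-1 * y)%g = ((w^-1 * x)^-1 * (w^-1 * y))%g.
  by rewrite invgM invgK -mulgA (mulgA w) mulgV mul1g.
by apply: parM => //; exact: parV.
Qed.

Lemma coset_gen w x K t : coset w K x -> coset w K (x * gen t)%g <-> K t.
Proof.
move=> Kx; rewrite -(coset_eq Kx) /coset /= mulgA mulVg mul1g.
by split; [exact: par_genP|exact: par_gen].
Qed.

Lemma coset_subP w K L : coset w K `<=` coset w L -> K `<=` L.
Proof.
move=> KL t Kt; apply: (iffLR (coset_gen t (@coset_refl w L))).
by apply: KL; exact: (iffRL (coset_gen t (@coset_refl w K)) Kt).
Qed.

Lemma cosetI w K L : coset w (K `&` L) = coset w K `&` coset w L.
Proof.
apply/seteqP; split => [x Kx|x [Kx Lx]]; last exact: parI.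
by split; apply: par_sub Kx => t [].
Qed.

End Parabolic.

End RootSystem.

(** * Subsets of finite type *)

Section FiniteType.
Context (R : realType) (S : coxeter_system).
Notation W := (cs_group S).
Notation Pi := (cs_index S).
Notation gen := (@cs_gen S).
Notation V := (cox_V R S).
Notation e := (@simple_root R S).
Notation "w • v" := (bij_fun (@geom R S w) v) (at level 40, left associativity).
Implicit Types (K L : set Pi) (w u : W) (b v : V).

Definition roots_in K : set V := [set b | is_root b /\ vanish K b].

(** Stated by roots rather than by finiteness of W_K, because the arguments below sum over and count
    roots. *)
Definition finite_type K := finite_set (roots_in K).

Lemma finite_type_sub K L : K `<=` L -> finite_type L -> finite_type K.
Proof.
move=> KL; apply: sub_finite_set => b [rb Kb]; split=> //.
exact: vanish_sub KL Kb.
Qed.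

Lemma finite_type_finite K : finite_type K -> finite_set K.
Proof.
move=> fK; apply: (@sub_finite_set _ _ (e @^-1` roots_in K)).
  by move=> t Kt; split; [exact: root_e|exact: vanish_e].
by apply: finite_preimage => // s t _ _; exact: root_inj.
Qed.

(** Apply the letters of [w] to [b] one at a time, a descent first: the root stays positive until it
    has become a simple root e_t. *)
Lemma par_make_neg K w b : parabolic K w -> is_root b -> pos b -> pos (- (w • b)) ->
  exists u t, [/\ parabolic K u, K t & b = u • e t].
Proof.
have [n] := ubnP (len w); elim: n w b => // n IH w b wn Kw rb pb neg.
have w1 : w <> 1%g by move=> w1; rewrite w1 geom1 in neg; exact: root_not_pos neg.
have [t nt] := exists_neg R w1; have Kt := par_neg Kw nt.
have [->|bt] := pselect (b = e t).
  by exists 1%g, t; split; [exact: par1| |rewrite geom1].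
have [|||||u [s [Ku Ks E]]] := IH (w * gen t)%g (gen t • b).
- exact: leq_trans (descent_len nt) wn.
- by apply: parM => //; exact: par_gen.
- exact: root_geom.
- exact: gen_pos.
- by rewrite -geomMv genK.
exists (gen t * u)%g, s; split=> //; first by apply: parM => //; exact: par_gen.
by rewrite geomMv -E -{1}(genV t) geomKv.
Qed.

Lemma neg_geom w K v : (forall t, K t -> pos (- (w • e t))) ->
  pos v -> vanish K v -> pos (- (w • v)).
Proof.
move=> wK pv Kv; rewrite geom_sum -sumrN big_seq; apply: pos_sum => s sv.
by rewrite -scalerN; apply: posZ; [exact: pv|apply/wK/(vanish_supp Kv)].
Qed.

Lemma spherical_finite K : spherical K -> finite_set K.
Proof.
move=> sK; apply: (@sub_finite_set _ _ (gen @^-1` parabolic K)).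
  by move=> t Kt; exact: par_gen.
by apply: finite_preimage => // s t _ _; exact: cs_gen_inj.
Qed.

(* A longest element of W_K makes all positive roots in the span of K negative. *)
Lemma spherical_finite_type K : spherical K -> finite_type K.
Proof.
move=> sK; pose P n := `[< exists2 w, parabolic K w & len w = n >].
have P0 : exists n, P n.
  by exists (len (1%g : W)); apply/asboolP; exists 1%g => //; exact: par1.
have Pmax n : P n -> (n <= \max_(w <- fset_set (parabolic K)) len w)%N.
  move=> /asboolP[w Kw <-]; apply: leq_bigmax_seq => //.
  by rewrite in_fset_set// inE.
have := ex_maxnP P0 Pmax; case: ex_maxnP => n /asboolP[w Kw wn] nmax _.
have wneg t : K t -> pos (- (w • e t)).
  move=> Kt; apply: root_neg_len; rewrite wn; apply: nmax; apply/asboolP.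
  by exists (w * gen t)%g => //; apply: parM => //; exact: par_gen.
apply: (@sub_finite_set _ _ ((fun p : W * Pi => p.1 • e p.2) @` (parabolic K `*` K))).
  move=> b [rb Kb]; case: (root_sign rb) => pb.
    have [u [t [Ku Kt ->]]] := par_make_neg Kw rb pb (neg_geom wneg pb Kb).
    by exists (u, t).
  have [u [t [Ku Kt E]]] :=
    par_make_neg Kw (root_opp rb) pb (neg_geom wneg pb (vanishN Kb)).
  exists (u * gen t, t)%g => /=.
    by split=> //; apply: parM => //; exact: par_gen.
  by rewrite geomMv gen_e geomN -E opprK.
by apply: finite_image; apply: finite_setX => //; exact: spherical_finite.
Qed.

(* A finite-type parabolic subgroup acts freely on its positive systems: some
   conjugate of u preserves the standard one, hence has length 0. *)
Lemma par_cone_eq1 K u (C : V -> Prop) : finite_type K -> C 0 ->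
  (forall x y : V, C x -> C y -> C (x + y)) ->
  (forall a x, 0 <= a -> C x -> C (a *: x)) ->
  (forall b, is_root b -> C b -> C (- b) -> False) ->
  (forall b, roots_in K b -> C b \/ C (- b)) ->
  parabolic K u -> (forall b, roots_in K b -> C b -> C (u • b)) -> u = 1%g.
Proof.
move=> fK C0 CD CZ Canti Ctot Ku Cu.
have hK h b : parabolic K h -> roots_in K b -> roots_in K (h • b).
  by move=> Kh [rb Kb]; split; [exact: root_geom|exact: par_vanish].
have eK t : K t -> roots_in K (e t) by move=> Kt; split; [exact: root_e|exact: vanish_e].
have oppK b : roots_in K b -> roots_in K (- b).
  by move=> [rb Kb]; split; [exact: root_opp|exact: vanishN].
(* [A h] measures how far [h] is from carrying [C] to the standard positive system. If h^-1 e_t is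
   not in [C], passing from h to t h removes the root - h^-1 e_t from [A h] and adds nothing. *)
pose A h := [set b | [/\ roots_in K b, C b & pos (- (h • b))]].
have fA h : finite_set (A h) by apply: sub_finite_set fK => b [].
have [h Kh hC] : exists2 h, parabolic K h & forall t, K t -> C (h^-1%g • e t).
  suff Hn n h : parabolic K h -> (#|` fset_set (A h)| < n)%N ->
      exists2 h, parabolic K h & forall t, K t -> C (h^-1%g • e t).
    by apply: (Hn _ 1%g _ (ltnSn _)); exact: par1.
  elim: n h => // n IH h Kh hn.
  have [[t Kt nC]|all] := pselect (exists2 t, K t & ~ C (h^-1%g • e t)); last first.
    by exists h => // t Kt; apply: contrapT => nC; apply: all; exists t.
  pose g := - (h^-1%g • e t).
  have gK : roots_in K g by apply/oppK/hK/eK => //; exact: parV.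
  have Cg : C g by case: (Ctot _ (hK _ _ (parV Kh) (eK _ Kt))).
  have hg : h • g = - e t by rewrite /g geomN geomVKv.
  apply: (IH (gen t * h)%g); first by apply: parM => //; exact: par_gen.
  rewrite -ltnS; apply: leq_trans hn; rewrite ltnS; apply: fproper_ltn_card.
  rewrite fproperE; apply/andP; split.
    apply/fsubsetP => b; rewrite !in_fset_set// !inE => -[bK Cb neg]; split=> //.
    have [rb _] := bK.
    case: (root_sign (root_geom h rb)) => // hp.
    have [hb|hb] := pselect (h • b = e t).
      case: (Canti g) => //; first by case: gK.
      by rewrite /g opprK -hb geomKv.
    have := gen_pos (root_geom h rb) hp hb; rewrite -geomMv => p.
    by case: (root_not_pos (root_geom _ rb) p neg).
  apply/fsubsetPn; exists g; rewrite in_fset_set//.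
    by apply/mem_set; split=> //; rewrite hg opprK; exact: pos_e.
  apply/negP => /set_mem[_ _]; rewrite geomMv hg geomN gen_e opprK.
  by apply: (root_not_pos (b := e t)); [exact: root_e|exact: pos_e].
have Kx : parabolic K (h * u * h^-1)%g.
  by apply: parM; [exact: parM|exact: parV].
suff : (h * u * h^-1 = 1)%g.
  move=> E; have -> : u = (h^-1 * (h * u * h^-1) * h)%g.
    by rewrite !mulgA mulVg mul1g -mulgA mulVg mulg1.
  by rewrite E mulg1 mulVg.
apply: (@par_eq1 R _ _ _ Kx) => t Kt.
have xK : roots_in K ((h * u * h^-1)%g • e t) by apply/hK/eK.
have [rx Vx] := xK.
case: (root_sign rx) => // neg.
have hCt := Cu _ (hK _ _ (parV Kh) (eK _ Kt)) (hC _ Kt).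
case: (Canti (u • (h^-1%g • e t))) => //; first by apply/root_geom/root_geom/root_e.
have -> : - (u • (h^-1%g • e t)) = h^-1%g • (- ((h * u * h^-1)%g • e t)).
  by rewrite !geomMv geomN geomKv.
move: neg (vanishN Vx); move: (- _) => y py Ky; rewrite geom_sum big_seq.
elim/big_ind: _ => // s sy; apply: CZ; first exact: py.
by apply: hC; exact: vanish_supp sy.
Qed.

(** * An invariant positive form, and the number of neighbours of a node *)

Section Neighbours.
Context (K : set Pi) (fK : finite_type K).

Let r : seq V := enum_fset (fset_set (roots_in K)).

Let rP b : (b \in r) <-> roots_in K b.
Proof. by rewrite -[b \in r]/(b \in fset_set _) in_fset_set// inE. Qed.

(** A semidefinite form invariant under W_K, obtained by summing over the roots instead of the
    group. Against each e_t it is a positive multiple of [bil], which is not known to be positive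
    itself. *)
Definition root_form v v' : R := \sum_(b <- r) bil v b * bil v' b.

Lemma root_form_gen t v v' : K t -> root_form (gen t • v) (gen t • v') = root_form v v'.
Proof.
move=> Kt; have tK b : roots_in K b -> roots_in K (gen t • b).
  by move=> [rb Kb]; split; [exact: root_geom|apply: par_vanish => //; exact: par_gen].
have permr : perm_eq r (map (fun b => gen t • b) r).
  apply: uniq_perm; [exact: fset_uniq|by rewrite map_inj_uniq ?fset_uniq//; exact: geom_inj|].
  move=> b; apply/idP/idP => [/rP bK|/mapP[c /rP/tK/rP + ->]//].
  by apply/mapP; exists (gen t • b); [exact/rP/tK|rewrite -{1}(genV t) geomKv].
rewrite [RHS]/root_form (perm_big _ permr) big_map.
by apply: eq_bigr => b _; rewrite !bil_geoml !genV.
Qed.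

Lemma root_formBl x y v : root_form (x - y) v = root_form x v - root_form y v.
Proof.
rewrite /root_form -sumrB; apply: eq_bigr => b _.
by rewrite bilDl bilNl mulrBl.
Qed.

Lemma root_formDr v x y : root_form v (x + y) = root_form v x + root_form v y.
Proof.
by rewrite /root_form -big_split; apply: eq_bigr => b _; rewrite bilDl mulrDr.
Qed.

Lemma root_formZl a x v : root_form (a *: x) v = a * root_form x v.
Proof. by rewrite /root_form mulr_sumr; apply: eq_bigr => b _; rewrite bilZl mulrA. Qed.

Lemma root_formZr a x v : root_form v (a *: x) = a * root_form v x.
Proof. by rewrite /root_form mulr_sumr; apply: eq_bigr => b _; rewrite bilZl mulrCA. Qed.

Lemma root_formNr x v : root_form v (- x) = - root_form v x.
Proof. by rewrite -scaleN1r root_formZr mulN1r. Qed.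

Lemma root_form_ge0 v : 0 <= root_form v v.
Proof. by apply: sumr_ge0 => b _; rewrite -expr2 sqr_ge0. Qed.

(** The reflection t is an isometry of this form and negates e_t, so the form determines its
    coefficient. *)
Lemma root_form_e t v : K t ->
  2 * root_form v (e t) = bil v (e t) * root_form (e t) (e t).
Proof.
move=> Kt; have := root_form_gen v (e t) Kt.
rewrite gen_e geom_genE root_formNr root_formBl root_formZl; lra.
Qed.

Lemma root_form_ee t : K t -> 0 < root_form (e t) (e t).
Proof.
move=> Kt; have tr : e t \in r by apply/rP; split; [exact: root_e|exact: vanish_e].
rewrite /root_form (big_rem _ tr) /= bil_ss ltr_wpDr//.
  by apply: sumr_ge0 => b _; rewrite -expr2 sqr_ge0.
by rewrite mulr_gt0.
Qed.

Lemma bil_le0 s t : s != t -> bil (e s) (e t) <= 0.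
Proof.
move=> st; rewrite bil_ee oppr_le0 -/(cox_c R s t).
have -> : cox_c R s t = cheb (cox_c R s t) 2 by rewrite chebS cheb1 cheb0 mulr1 subr0.
apply: cheb_ge0 => //; have := cox_m_neq1 st.
by case: (cox_m s t) => [|[|m]] // _; [left|right].
Qed.

(** Here m is infinite or at least 3, so c^2 - 1, the value of [cheb] at 3, is nonnegative; with c
    >= 0 this gives c >= 1. *)
Lemma bil_le_N1 s t : s != t -> bil (e s) (e t) != 0 -> bil (e s) (e t) <= - 1.
Proof.
move=> st; have := bil_le0 st; rewrite !bil_ee oppr_le0 -/(cox_c R s t) => c0 cn0.
have m2 : cox_m s t <> 2%N.
  move=> m2; move: cn0; rewrite /cox_c m2.
  by rewrite cos_pihalf mulr0 oppr0 eqxx.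
have : 0 <= cheb (cox_c R s t) 3.
  apply: cheb_ge0 => //; have := cox_m_neq1 st; move: m2.
  by case: (cox_m s t) => [|[|[|m]]] // _ _; [left|right].
rewrite !chebS cheb1 cheb0 mulr1 subr0 => c1.
rewrite lerN2; nra.
Qed.

(* With 5 or more neighbours t of s, the vector 2 e_s + sum of the e_t would have
   negative norm for the positive form root_form. *)
Lemma card_neighbours s (T : {fset Pi}) : K s ->
  (forall t, t \in T -> [/\ K t, t != s & bil (e s) (e t) != 0]) ->
  (#|` T| <= 4)%N.
Proof.
move=> Ks TP; rewrite leqNgt; apply/negP => T5.
pose v := 2 *: e s + \sum_(t <- T) e t.
have sumT x : bil (\sum_(t <- T) e t) x = \sum_(t <- T) bil (e t) x.
  by elim/big_rec2: _ => [|t a b _ <-]; rewrite ?bil0l ?bilDl.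
(* The bound is 4 - 5: each neighbour contributes at most -1. *)
have vs : bil v (e s) <= - 1.
  rewrite bilDl bilZl bil_ss sumT.
  have : \sum_(t <- T) bil (e t) (e s) <= \sum_(t <- T) (- 1).
    rewrite !big_seq; apply: ler_sum => t /TP[_ ts b0].
    by apply: bil_le_N1 => //; rewrite bilC.
  have -> : \sum_(t <- T) (- 1) = - (size T)%:R :> R.
    by rewrite big_const_seq count_predT iter_addr_0 mulNrn.
  move=> le.
  have : 5%:R <= (size T)%:R :> R by rewrite ler_nat.
  rewrite -[5%:R]/(5 : R); lra.
(* The norm 2 of e_t is cancelled by 2 (e_s, e_t) <= -2; the other neighbours contribute nothing
   positive. *)
have vt t : t \in T -> bil v (e t) <= 0.
  move=> tT; have [Kt ts b0] := TP t tT.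
  rewrite bilDl bilZl sumT (big_rem _ tT) /= bil_ss.
  have st : s != t by rewrite eq_sym.
  have := bil_le_N1 st b0.
  have : \sum_(y <- rem t T) bil (e y) (e t) <= 0.
    rewrite big_seq; apply: sumr_le0 => y.
    by rewrite mem_rem_uniq ?fset_uniq// inE => /andP[yt _]; exact: bil_le0.
  lra.
have := root_form_ge0 v; rewrite {2}/v root_formDr root_formZr root_form_e//.
have sum_le0 : root_form v (\sum_(t <- T) e t) <= 0.
  have -> : root_form v (\sum_(t <- T) e t) = \sum_(t <- T) root_form v (e t).
    elim/big_rec2: _ => [|t a b _ <-]; rewrite ?root_formDr//.
    by rewrite -[0 in LHS](scale0r (e s)) root_formZr mul0r.
  rewrite big_seq; apply: sumr_le0 => t tT; have [Kt ts b0] := TP t tT.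
  have := root_form_e v Kt; have := root_form_ee Kt; have := vt t tT.
  nra.
have := root_form_ee Ks; nra.
Qed.

End Neighbours.

(** A positive system for a lexicographic order: the pairings with the e_t, t in [l], are compared
    first, and the standard sign only breaks ties. An element fixing these e_t and preserving the
    positive roots orthogonal to them preserves this system. *)
Fixpoint lexpos (l : seq Pi) v : Prop :=
  if l is t :: l' then 0 < bil v (e t) \/ bil v (e t) = 0 /\ lexpos l' v
  else pos v.

Lemma lexpos0 l : lexpos l 0.
Proof. by elim: l => [s|t l IH] /=; [rewrite mcoeff0|right; rewrite bil0l]. Qed.

Lemma lexposD l x y : lexpos l x -> lexpos l y -> lexpos l (x + y).
Proof.
elim: l => [|t l IH] /=; first exact: posD.
rewrite bilDl => -[x0|[x0 lx]] [y0|[y0 ly]].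
- by left; exact: addr_gt0.
- by left; rewrite y0 addr0.
- by left; rewrite x0 add0r.
- by right; rewrite x0 y0 addr0; split=> //; exact: IH.
Qed.

Lemma lexposZ l a x : 0 <= a -> lexpos l x -> lexpos l (a *: x).
Proof.
rewrite le_eqVlt => /predU1P[<- _|a0]; first by rewrite scale0r; exact: lexpos0.
elim: l => [|t l IH] /=; first by apply: posZ; exact: ltW.
rewrite bilZl => -[x0|[-> lx]]; first by left; exact: mulr_gt0.
by right; rewrite mulr0; split=> //; exact: IH.
Qed.

Lemma lexpos_anti l x : lexpos l x -> lexpos l (- x) -> x = 0.
Proof.
elim: l => [|t l IH] /=; first exact: pos_anti.
rewrite bilNl oppr_gt0 => -[x0|[x0 lx]] [y0|[y0 ly]]; last exact: IH.
- by have := lt_trans x0 y0; rewrite ltxx.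
- by move/eqP: y0; rewrite oppr_eq0 gt_eqF.
- by rewrite x0 ltxx in y0.
Qed.

Lemma lexpos_total l b : is_root b -> lexpos l b \/ lexpos l (- b).
Proof.
move=> rb; elim: l => [|t l IH] /=; first exact: root_sign.
rewrite bilNl oppr_gt0.
case: (ltgtP (bil b (e t)) 0) => [b0|b0|->].
- by right; left.
- by left; left.
- by rewrite oppr0; case: IH; [left|right]; right.
Qed.

Lemma lexpos_geom l u b : (forall t, t \in l -> u • e t = e t) ->
  ((forall t, t \in l -> bil b (e t) = 0) -> pos b -> pos (u • b)) ->
  lexpos l b -> lexpos l (u • b).
Proof.
elim: l => [|t l IH] /= ul up; first by apply: up.
have bt : bil (u • b) (e t) = bil b (e t).
  by rewrite -{1}(ul t) ?mem_head// bil_geom.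
rewrite bt => -[b0|[b0 lb]]; [by left|right; split=> //].
apply: IH => // [s sl|l0]; first by apply: ul; rewrite inE sl orbT.
by apply: up => s; rewrite inE => /predU1P[->|/l0].
Qed.

(* Steinberg's fixed point theorem in disguise. *)
Lemma par_fix_eq1 K u (l : seq Pi) : finite_type K -> parabolic K u ->
  (forall t, t \in l -> u • e t = e t) ->
  (forall b, is_root b -> pos b -> (forall t, t \in l -> bil b (e t) = 0) -> pos (u • b)) ->
  u = 1%g.
Proof.
move=> fK Ku ul up; apply: (par_cone_eq1 (C := lexpos l) fK) => //.
- exact: lexpos0.
- exact: lexposD.
- exact: lexposZ.
- by move=> b rb lb lnb; apply: (root_neq0 rb); exact: lexpos_anti lb lnb.
- by move=> b [rb _]; exact: lexpos_total.
- by move=> b [rb _]; apply: lexpos_geom => // l0 pb; exact: up.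
Qed.

End FiniteType.

(** * The cell complex *)

Section Vertices.
Context (R : realType) (S : coxeter_system).
Notation W := (cs_group S).
Notation Pi := (cs_index S).
Notation gen := (@cs_gen S).
Notation V := (cox_V R S).
Notation e := (@simple_root R S).
Notation "w • v" := (bij_fun (@geom R S w) v) (at level 40, left associativity).
Context (J : set Pi) (fJ : finite_type R J).
Implicit Types (K L : set Pi) (w u g : W) (b v : V).

Definition perp b := forall j, J j -> bil b (e j) = 0.

Definition fixes_J g := (forall j, J j -> g • e j = e j) /\
  forall b, is_root b -> pos b -> perp b -> pos (g^-1%g • b).

(** Geometrically, [w] takes the fundamental chamber to one that has a face in the subspace fixed by
    W_J and lies on the positive side of every root orthogonal to [J]. *)
Definition vertex w := (forall j, J j -> exists t, w^-1%g • e j = e t) /\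
  forall b, is_root b -> pos b -> perp b -> pos (w^-1%g • b).

Definition J_at w : set Pi := [set t | exists2 j, J j & w • e t = e j].

Lemma perp_fix g b : (forall j, J j -> g • e j = e j) -> perp b -> perp (g^-1%g • b).
Proof.
by move=> gJ pb j Jj; rewrite -[e j](geomKv g) bil_geom gJ// pb.
Qed.

Lemma vertex1 : vertex 1%g.
Proof.
split=> [j _|b _ pb _]; last by rewrite invg1 geom1.
by exists j; rewrite invg1 geom1.
Qed.

Lemma vertexM g w : fixes_J g -> vertex w -> vertex (g * w)%g.
Proof.
move=> [gJ gp] [wJ wp]; split=> [j Jj|b rb pb pJ].
  have [t E] := wJ j Jj; exists t.
  by rewrite invgM geomMv -{1}(gJ j Jj) geomKv.
rewrite invgM geomMv; apply: wp; [exact: root_geom|exact: gp|exact: perp_fix].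
Qed.

Lemma vertex_J_at w j : vertex w -> J j -> exists2 t, J_at w t & w^-1%g • e j = e t.
Proof.
move=> [wJ _] Jj; have [t E] := wJ j Jj; exists t => //; exists j => //.
by rewrite -E geomVKv.
Qed.

Lemma vertex_vanish w b : vertex w -> vanish J b -> vanish (J_at w) (w^-1%g • b).
Proof.
move=> vw Jb; rewrite geom_sum big_seq; elim/big_ind: _ => //.
- by move=> t _; rewrite mcoeff0.
- by move=> x y; exact: vanishD.
move=> s sb; apply: vanishZ; have [t Jt ->] := vertex_J_at vw (vanish_supp Jb sb).
exact: vanish_e.
Qed.

Lemma J_at_vanish w b : vanish (J_at w) b -> vanish J (w • b).
Proof.
move=> Jb; rewrite geom_sum big_seq; elim/big_ind: _ => //.
- by move=> t _; rewrite mcoeff0.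
- by move=> x y; exact: vanishD.
move=> s /(vanish_supp Jb)[j Jj ->]; apply: vanishZ; exact: vanish_e.
Qed.

(* The shortest element m of w W_L is again a vertex: m^-1 e_j is a positive root in
   the span of L, and it is simple since m maps simple roots of L to positive roots
   whose combination is the simple root e_j. *)
Lemma vertex_coset w L u : vertex w -> J_at w `<=` L -> parabolic L u ->
  (forall t, L t -> pos ((w * u)%g • e t)) -> vertex (w * u)%g.
Proof.
move=> vw JL Lu pL; set m := (w * u)%g in pL *.
have posL b : is_root b -> vanish L b -> pos (m • b) -> pos b.
  move=> rb Lb pm; case: (root_sign rb) => // nb.
  case: (root_not_pos (root_geom m rb) pm).
  by rewrite -geomN; exact: pos_geom pL nb (vanishN Lb).
have mV v : m^-1%g • v = u^-1%g • (w^-1%g • v) by rewrite invgM geomMv.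
split=> [j Jj|b rb pb pJ].
  set c := m^-1%g • e j.
  have rc : is_root c by apply/root_geom/root_e.
  have mc : m • c = e j by rewrite geomVKv.
  have Lc : vanish L c.
    rewrite /c mV; apply: par_vanish; first exact: parV.
    by have [t /JL Lt ->] := vertex_J_at vw Jj; exact: vanish_e.
  have pc : pos c by apply: posL => //; rewrite mc; exact: pos_e.
  have [s sc] : exists s, s \in msupp c.
    apply: contrapT => ns; apply: (root_neq0 rc); apply/malgP => s; rewrite mcoeff0.
    by apply/eqP; rewrite mcoeff_eq0; apply/negP => sc; apply: ns; exists s.
  have c0 : 0 < c@_s by rewrite lt_def mcoeff_neq0 sc pc.
  have Ls := vanish_supp Lc sc.
  exists s; apply: (@geom_inj R S m) => /=.
  rewrite mc; apply/esym; apply: (root_le_simple (c := c@_s)) => //.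
  - by apply/root_geom/root_e.
  - exact: pL.
  rewrite -mc -geomZ -geomN -geomD; apply: pos_geom pL _ _.
    move=> t; rewrite mcoeffB mcoeffZ mcoeff_e; case: eqVneq => [<-|_].
      by rewrite mulr1 subrr.
    by rewrite mulr0 subr0 pc.
  by apply: vanishD => //; apply/vanishN/vanishZ/vanish_e.
have := (vw.2 b rb pb pJ); set c := w^-1%g • b => pc.
have rc : is_root c by exact: root_geom.
rewrite mV -/c; have [Lc|nLc] := pselect (vanish L c).
  apply: posL; [exact: root_geom|by apply: par_vanish => //; exact: parV|].
  by rewrite -geomMv -mulgA mulgV mulg1 /c geomVKv.
have [t nLt ct] : exists2 t, ~ L t & c@_t != 0.
  apply: contrapT => nt; apply: nLc => t nLt; apply/eqP; apply: contrapT => /negP ct.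
  by apply: nt; exists t.
case: (root_sign (root_geom u^-1%g rc)) => // neg.
have := neg t; rewrite mcoeffN (par_coef _ (parV Lu))// oppr_ge0 => ct0.
by case/eqP: ct; apply/eqP; rewrite eq_le ct0 pc.
Qed.

Lemma J_at_coset w K x : vertex w -> J_at w `<=` K -> coset w K x -> J_at x `<=` K.
Proof.
move=> vw JK Kx t [j Jj E]; apply: (@vanish_eP R).
have [s /JK Ks Es] := vertex_J_at vw Jj.
have -> : e t = (w^-1 * x)^-1%g • e s.
  by rewrite -Es invgM invgK geomMv geomVKv -E geomKv.
by apply: par_vanish; [exact: parV|exact: vanish_e].
Qed.

Definition desc w : set Pi := J_at w `|` [set t | pos (- (w • e t))].

(** Let t be a descent outside J_w with b_t > 0. Then w e_t has a negative coefficient at some i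
    outside [J]. At i the other terms of w b are at most 0, since J_w is mapped into [J] and
    descents to negative roots; so w b is not positive. *)
Lemma desc_vanish w b : vertex w -> is_root b -> pos b -> vanish (desc w) b ->
  pos (w • b) -> vanish (J_at w) b.
Proof.
move=> vw rb pb Db pwb t nJt; apply: contrapT => /eqP bt.
have [neg|/(Db t)/eqP bt0] := pselect (desc w t); last by rewrite bt0 in bt.
case: neg => // neg.
have [i nJi wi] : exists2 i, ~ J i & (w • e t)@_i != 0.
  apply: contrapT => ni; apply: nJt; apply: (@vanish_eP R).
  rewrite -[e t](geomKv w); apply: vertex_vanish => // i nJi; apply/eqP.
  by apply: contrapT => /negP wi; apply: ni; exists i.
have wi0 : (w • e t)@_i < 0.
  by rewrite lt_def eq_sym wi /=; have := neg i; rewrite mcoeffN oppr_ge0.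
have := pwb i; rewrite geom_sum.
rewrite (raddf_sum (mcoeff i)) /=; have tb : t \in msupp b by rewrite -mcoeff_neq0.
rewrite (big_rem _ tb) /= leNgt => /negP; apply.
rewrite -[X in _ < X]addr0; apply: ltr_leD.
  rewrite mcoeffZ pmulr_rlt0// lt_def bt; exact: pb.
rewrite big_seq; apply: sumr_le0 => s /mem_rem sb.
rewrite mcoeffZ; apply: mulr_ge0_le0; first exact: pb.
case: (vanish_supp Db sb) => [[j Jj ->]|/(_ i)]; last by rewrite mcoeffN oppr_ge0.
by rewrite mcoeff_e; case: eqP => // ji; case: nJi; rewrite -ji.
Qed.

(** A positive root in the span of [desc w] is an inversion of [w] or comes from the finite root
    system of [J]. *)
Lemma desc_finite_type w : vertex w -> finite_type R (desc w).
Proof.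
move=> vw; pose A := inversions w `|` ((fun b => w^-1%g • b) @` roots_in J).
have fA : finite_set A.
  by rewrite finite_setU; split; [exact: finite_inversions|exact: finite_image].
have posA b : roots_in (desc w) b -> pos b -> A b.
  move=> [rb Db] pb; case: (root_sign (root_geom w rb)) => wb; [right|by left].
  exists (w • b); last exact: geomKv.
  by split; [exact: root_geom|exact/J_at_vanish/desc_vanish].
apply: (@sub_finite_set _ _ (A `|` (-%R @` A))); last first.
  by rewrite finite_setU; split=> //; exact: finite_image.
move=> b [rb Db]; case: (root_sign rb) => pb; [left|right]; first exact: posA.
exists (- b); last by rewrite opprK.
by apply: posA => //; split; [exact: root_opp|exact: vanishN].
Qed.

Lemma desc_adjacent w t : vertex w -> desc w t -> ~ J_at w t ->
  exists2 s, J_at w s & bil (e s) (e t) != 0.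
Proof.
move=> vw [//|neg] nJt; apply: contrapT => no.
have perpb : perp (- (w • e t)).
  move=> j Jj; have [s Js Es] := vertex_J_at vw Jj.
  rewrite bilNl bil_geoml Es bilC; apply/eqP; rewrite oppr_eq0.
  by apply: contrapT => /negP bst; apply: no; exists s.
have rb : is_root (- (w • e t)) by apply/root_opp/root_geom/root_e.
have := vw.2 _ rb neg perpb; rewrite geomN geomKv => p.
by apply: (root_not_pos (b := e t)) => //; [exact: root_e|exact: pos_e].
Qed.

(** The 5 is 1 + 4: the nodes of J_w, and at most 4 neighbours of each. *)
Definition rank_bound := (5 * #|` fset_set J|)%N.

Let finJ : finite_set J. Proof. exact: finite_type_finite fJ. Qed.

Lemma finite_desc w : vertex w -> finite_set (desc w).
Proof. by move=> /desc_finite_type; exact: finite_type_finite. Qed.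

Lemma finite_J_at w : vertex w -> finite_set (J_at w).
Proof. by move=> /finite_desc; apply: sub_finite_set => t; left. Qed.

Lemma card_J_at w : vertex w -> (#|` fset_set (J_at w)| <= #|` fset_set J|)%N.
Proof.
move=> vw; have fJw := finite_J_at vw.
have ex j : exists t, J j -> w^-1%g • e j = e t.
  have [Jj|nJj] := pselect (J j); first by have [t] := vw.1 j Jj; exists t.
  by exists j.
pose f j := projT1 (cid (ex j)).
have fE j : J j -> w^-1%g • e j = e (f j) by rewrite /f; case: cid.
have le : (#|` f @` fset_set J|%fset <= #|` fset_set J|)%N by exact: leq_imfset_card.
apply: leq_trans le.
apply: fsubset_leq_card; apply/fsubsetP => t; rewrite in_fset_set// inE => -[j Jj E].
apply/imfsetP; exists j; first by rewrite /= in_fset_set// inE.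
by apply: (@root_inj R S); rewrite -fE// -E geomKv.
Qed.

Lemma card_desc w : vertex w -> (#|` fset_set (desc w)| <= rank_bound)%N.
Proof.
move=> vw; have fD := finite_desc vw; have fJw := finite_J_at vw.
pose A := fset_set (J_at w); pose B := fset_set (desc w).
pose F s := [fset t in B | (t != s) && (bil (e s) (e t) != 0)]%fset.
have sub : (B `<=` A `|` \bigcup_(s <- A) F s)%fset.
  apply/fsubsetP => t tB; rewrite in_fsetU; have [tA|tA] := boolP (t \in A) => //=.
  have Dt : desc w t by move: tB; rewrite in_fset_set// inE.
  have nJt : ~ J_at w t by move=> Jt; case/negP: tA; rewrite in_fset_set// inE.
  have [s Js st] := desc_adjacent vw Dt nJt.
  have sA : s \in A by rewrite in_fset_set// inE.
  apply/bigfcupP; exists s; first by rewrite sA.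
  rewrite !inE /= tB st andbT; apply/eqP => ts; exact/nJt/(eq_ind_r _ Js ts).
apply: leq_trans (fsubset_leq_card sub) _.
apply: leq_trans (_ : (#|` A| + \sum_(s <- A) 4 <= _)%N); last first.
  by rewrite big_const_seq count_predT iter_addn_0 -mulSn leq_mul2l card_J_at.
rewrite cardfsU; apply: leq_trans (leq_subr _ _) _; rewrite leq_add2l.
apply: leq_trans (_ : (\sum_(s <- A) #|` F s| <= _)%N); last first.
  rewrite !big_seq; apply: leq_sum => s; rewrite in_fset_set// inE => Js.
  apply: (card_neighbours (desc_finite_type vw)) (_ : desc w s) _; first by left.
  move=> t; rewrite !inE /= => /andP[tB /andP[ts st]]; split=> //.
  by move: tB; rewrite in_fset_set// inE.
elim/big_ind2: _ => // m x n y xm yn.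
by rewrite cardfsU (leq_trans (leq_subr _ _))// leq_add.
Qed.

End Vertices.

(** * The complex of cosets and its combinatorial data *)

Section Cells.
Context (R : realType) (S : coxeter_system).
Notation W := (cs_group S).
Notation Pi := (cs_index S).
Notation gen := (@cs_gen S).
Notation V := (cox_V R S).
Notation e := (@simple_root R S).
Notation "w • v" := (bij_fun (@geom R S w) v) (at level 40, left associativity).
Context (J : set Pi) (fJ : finite_type R J).
Notation vertex := (@vertex R S J).
Notation J_at := (@J_at R S J).
Notation desc := (@desc R S J).
Notation fixes_J := (@fixes_J R S J).
Implicit Types (K L : set Pi) (w u g m : W) (F : set W) (s : seq (set W)).

(* The bound on K stands for the condition that no reflection in w W_K w^-1 fixes J:
   it is the only consequence of the latter that is needed. *)
Definition cell_type w K :=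
  [/\ J_at w `<=` K, finite_type R K & (#|` fset_set K| <= rank_bound J)%N].

Definition cell w F := exists2 K, cell_type w K & F = coset w K.

Definition cells_at w s := vertex w /\ forall F, F \in s -> cell w F.

Definition compat s := exists w, cells_at w s.

Definition cap s : set W := [set x | forall F, F \in s -> F x].

Definition lowest s m := cells_at m s /\
  forall t, cap s (m * gen t)%g -> pos (m • e t).

Lemma cell_self w F : cell w F -> F w.
Proof. by move=> [K _ ->]; exact: coset_refl. Qed.

Lemma cells_at_cap w s : cells_at w s -> cap s w.
Proof. by move=> [_ ws] F /ws; exact: cell_self. Qed.

Lemma cell_move w x F : vertex w -> cell w F -> F x -> cell x F.
Proof.
move=> vw [K [JK fK cK] ->] Kx; exists K; last exact/esym/coset_eq.
by split=> //; exact: J_at_coset Kx.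
Qed.

Lemma cap_cons F s : cap (F :: s) = F `&` cap s.
Proof.
apply/seteqP; split => x /=.
  move=> Fs; split; first by apply: Fs; rewrite mem_head.
  by move=> G Gs; apply: Fs; rewrite inE Gs orbT.
by move=> [Fx sx] G; rewrite inE => /orP[/eqP ->//|/sx].
Qed.

(** Cosets through a common [w] intersect in the coset of the intersected types. The empty tuple
    gives the whole group, which may be of infinite type; hence the condition in the last clause. *)
Lemma cap_coset w s : cells_at w s -> exists L, [/\ J_at w `<=` L,
  cap s = coset w L & s != [::] -> cell_type w L].
Proof.
move=> [vw]; elim: s => [_|F s IH ws].
  exists setT; split=> //; apply/seteqP; split=> x // _.
  have : setT (w^-1 * x)%g by [].
  by rewrite -(cs_generated S) /coset /= /parabolic.
have [|L [JL sL _]] := IH; first by move=> G Gs; apply: ws; rewrite inE Gs orbT.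
have [|K [JK fK cK] FE] := ws F; first exact: mem_head.
have finK := finite_type_finite fK.
exists (K `&` L); split.
- by move=> t Jt; split; [exact: JK|exact: JL].
- by rewrite cap_cons sL FE cosetI.
move=> _; split.
- by move=> t Jt; split; [exact: JK|exact: JL].
- by apply: finite_type_sub fK => t [].
- apply: leq_trans cK; apply: fsubset_leq_card.
  have finKL : finite_set (K `&` L) by apply: sub_finite_set finK => t [].
  by rewrite -fset_set_sub//; exact: subIsetl.
Qed.

Lemma exists_lowest w s : cells_at w s ->
  exists2 m, lowest s m & m = w \/ (len m < len w)%N.
Proof.
move=> ws; have [L [JL sL _]] := cap_coset ws; have [vw wc] := ws.
have [m [u [wE Lu mL ml]]] := coset_min R L w.
have mE : m = (w * u^-1)%g by rewrite wE -mulgA mulgV mulg1.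
have Lm : coset w L m by rewrite mE; apply: coset_mul; exact: parV.
have vm : vertex m.
  by rewrite mE; apply: vertex_coset JL _ _ => //; [exact: parV|rewrite -mE].
exists m => //; split.
  split=> // F Fs; apply: (cell_move vw) (wc F Fs) _.
  by move: Lm; rewrite -sL; exact.
by move=> t; rewrite sL => /(coset_gen R t Lm)/mL.
Qed.

(** Write m' = m u with u in W_L. As m preserves positivity on the span of L, a descent of u in L
    would be one of m'; so u has none. *)
Lemma lowest_unique s m m' : lowest s m -> lowest s m' -> m = m'.
Proof.
move=> [ms mp] [ms' mp']; have [L [JL sL _]] := cap_coset ms.
have Lm' : coset m L m' by rewrite -sL; exact: cells_at_cap ms'.
have u1 : (m^-1 * m')%g = 1%g; last first.
  by rewrite -[m in LHS]mulg1 -u1 mulgA mulgV mul1g.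
apply: (par_eq1 (R := R) Lm') => t Lt.
have rt : is_root ((m^-1 * m')%g • e t) by apply/root_geom/root_e.
case: (root_sign rt) => // neg.
have mL r : L r -> pos (m • e r).
  by move=> Lr; apply: mp; rewrite sL; apply/(coset_gen R r (@coset_refl _ m L)).
have p' : pos (m' • e t).
  by apply: mp'; rewrite sL; apply/(coset_gen R t Lm').
have n' : pos (- (m' • e t)).
  have -> : - (m' • e t) = m • (- ((m^-1 * m')%g • e t)).
    by rewrite geomN geomMv geomVKv.
  apply: (pos_geom mL neg); apply/vanishN/par_vanish => //; exact: vanish_e.
case: (root_not_pos _ p' n'); exact/root_geom/root_e.
Qed.

Definition low s : W := xget 1%g (lowest s).

Lemma lowP s : compat s -> lowest s (low s).
Proof. by move=> [w /exists_lowest[m mP _]]; exact: xgetPex (ex_intro _ m mP). Qed.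

Lemma low_eq s m : lowest s m -> low s = m.
Proof. by move=> mP; apply: (lowest_unique _ mP); apply: lowP; exists m; case: mP. Qed.

Lemma low_len w s : cells_at w s -> low s = w \/ (len (low s) < len w)%N.
Proof. by move=> /exists_lowest[m /low_eq ->]. Qed.

Definition apex s : set W := coset (low s) (desc (low s)).

Definition level s := len (low s).

Lemma apex_cells_at s : compat s -> cells_at (low s) (apex s :: s).
Proof.
move=> /lowP[[vw ws] _]; split=> // F; rewrite inE => /orP[/eqP ->|/ws//].
exists (desc (low s)) => //; split.
- by move=> t; left.
- exact: desc_finite_type.
- exact: card_desc.
Qed.

Lemma compat_nil : compat [::].
Proof. by exists 1%g; split=> //; exact: vertex1. Qed.

Lemma compat_sub s t : subseq t s -> compat s -> compat t.
Proof. by move=> /mem_subseq ts [w [vw ws]]; exists w; split=> // F /ts/ws. Qed.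

Lemma apexP s : compat s -> compat (apex s :: s).
Proof. by move=> /apex_cells_at; exists (low s). Qed.

Lemma levelP s t : compat s -> face t s -> apex t = apex s \/
  (level (apex s :: t) < level s)%N /\ (level (apex t :: t) < level s)%N.
Proof.
move=> sC /andP[ts _]; have [[vw ws] _] := lowP sC.
have tC := compat_sub ts sC; set w := low s in vw ws *.
have wt : cells_at w t by split=> // F /(mem_subseq ts)/ws.
have [[r tr neg]|no] := pselect (exists2 r, cap t (w * gen r)%g & pos (- (w • e r))); last first.
  left; rewrite /apex (@low_eq t w)//; split=> // r tr.
  case: (root_sign (root_geom w (root_e R r))) => // neg.
  by case: no; exists r.
have notlow s' : cap s' (w * gen r)%g -> ~ lowest s' w.
  move=> s'r [_ /(_ r s'r) p].
  by apply: root_not_pos p neg; exact/root_geom/root_e.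
right; split.
  have at_w : cells_at w (apex s :: t).
    split=> // F; rewrite inE => /orP[/eqP ->|]; last by case: wt => _; exact.
    by apply: (apex_cells_at sC).2; exact: mem_head.
  case: (low_len at_w) => [E|//]; case: (notlow (apex s :: t)).
    rewrite cap_cons; split=> //; apply/(coset_gen R r (@coset_refl _ w (desc w))).
    by right.
  by rewrite -E; apply: lowP; exists w.
have lt : (len (low t) < len w)%N.
  case: (low_len wt) => [E|//]; case: (notlow t tr); rewrite -E.
  exact: lowP.
(* [low t] lies in its own apex, so coning [t] cannot raise the level. *)
by case: (low_len (apex_cells_at tC)) => [E|lt']; [rewrite /level E|exact: ltn_trans lt' lt].
Qed.

(** Reads the size of K off the coset w W_K as a bare set, without a choice of w or K. *)
Definition rk F := #|` fset_set [set t | exists2 x, F x & F (x * gen t)%g]|.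

Lemma rk_coset w K : rk (coset w K) = #|` fset_set K|.
Proof.
rewrite /rk; congr (#|` fset_set _|); apply/seteqP; split => t /=.
  by move=> [x Kx]; rewrite (coset_gen R t Kx).
move=> Kt; exists w; first exact: coset_refl.
by apply/(coset_gen R t (@coset_refl _ w K)).
Qed.

Lemma capP s t : compat s -> face t s -> t != [::] ->
  cap t = cap s \/ (rk (cap s) < rk (cap t))%N.
Proof.
move=> [w ws] /andP[/mem_subseq ts _] t0; have [vw wc] := ws.
have wt : cells_at w t by split=> // F /ts/wc.
have [L [JL sL _]] := cap_coset ws.
have [K [JK tK /(_ t0)[_ fK _]]] := cap_coset wt.
have LK : L `<=` K.
  apply: (@coset_subP R _ w); rewrite -sL -tK => x sx F /ts; exact: sx.
have finK := finite_type_finite fK; have finL := sub_finite_set LK finK.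
have [E|E] := pselect (L = K); [by left; rewrite sL tK E|right].
rewrite sL tK !rk_coset; apply: fproper_ltn_card.
rewrite fproperE; apply/andP; split; first by rewrite -fset_set_sub.
by apply/negP; rewrite -fset_set_sub// => KL; apply: E; apply/seteqP.
Qed.

Lemma cap_cell w s : cells_at w s -> s != [::] -> cell w (cap s).
Proof. by move=> ws s0; have [L [_ sL /(_ s0)]] := cap_coset ws; exists L. Qed.

Lemma rk_le F : is_cap compat cap F -> (rk F <= rank_bound J)%N.
Proof.
move=> [s [[w ws] s0 ->]]; have [K [_ _ cK] ->] := cap_cell ws s0.
by rewrite rk_coset.
Qed.

Definition translate g F : set W := [set x | F (g^-1 * x)%g].

Lemma translate1 F : translate 1%g F = F.
Proof. by apply/seteqP; split => x; rewrite /translate /= invg1 mul1g. Qed.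

Lemma translateM g h F : translate (g * h)%g F = translate g (translate h F).
Proof. by apply/seteqP; split => x; rewrite /translate /= invgM mulgA. Qed.

Lemma translate_coset g w K : translate g (coset w K) = coset (g * w)%g K.
Proof. by apply/seteqP; split => x; rewrite /translate /coset /= invgM mulgA. Qed.

Lemma cap_translate g s : cap (map (translate g) s) = translate g (cap s).
Proof.
apply/seteqP; split => x /= sx F.
  by move=> Fs; apply: (sx (translate g F)); exact: map_f.
by move=> /mapP[G Gs ->]; exact: sx.
Qed.

Lemma J_at_mul g w : fixes_J g -> J_at (g * w)%g = J_at w.
Proof.
move=> [gJ _]; apply/seteqP; split => t [j Jj E]; exists j => //.
  by apply: (@geom_inj R S g); rewrite /= -geomMv E gJ.
by rewrite geomMv E gJ.
Qed.

Lemma compat_translate g s : fixes_J g -> compat s -> compat (map (translate g) s).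
Proof.
move=> gJ [w [vw ws]]; exists (g * w)%g; split; first exact: vertexM.
move=> _ /mapP[F /ws[K [JK fK cK] ->] ->]; exists K; last exact: translate_coset.
by split=> //; rewrite J_at_mul.
Qed.

(** The conjugate w^-1 g w lies in W_K, fixes the simple roots of J_w and preserves the positive
    roots orthogonal to them, so [par_fix_eq1] applies. *)
Lemma fixes_J_free g w F : fixes_J g -> fixes_J g^-1%g -> vertex w -> cell w F ->
  translate g F = F -> g = 1%g.
Proof.
move=> gJ gJ' vw [K [JK fK _] FE] gF.
have Ku : parabolic K (w^-1 * (g * w))%g.
  suff : F (g * w)%g by rewrite FE.
  by rewrite -gF /translate /= mulgA mulVg mul1g FE; exact: coset_refl.
suff : (w^-1 * (g * w) = 1)%g.
  move=> E; have : (g * w = w)%g by apply: (mulgI w^-1%g); rewrite E mulVg.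
  by move=> gw; apply: (mulIg w); rewrite gw mul1g.
have finJ := sub_finite_set JK (finite_type_finite fK).
apply: (par_fix_eq1 (l := fset_set (J_at w)) fK Ku).
  move=> t; rewrite in_fset_set// inE => -[j Jj E].
  by rewrite !geomMv E gJ.1// -E geomKv.
move=> b rb pb bJ; rewrite !geomMv.
have perp_wb : perp J (w • b).
  move=> j Jj; have [t Jt Et] := vertex_J_at vw Jj.
  by rewrite bil_geoml Et bJ// in_fset_set// inE.
(* Otherwise - w b would be a positive root orthogonal to [J] which w^-1 makes negative. *)
have pwb : pos (w • b).
  case: (root_sign (root_geom w rb)) => // neg.
  have perpN : perp J (- (w • b)) by move=> j Jj; rewrite bilNl perp_wb// oppr0.
  have := vw.2 _ (root_opp (root_geom w rb)) neg perpN; rewrite geomN geomKv.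
  by move/(root_not_pos rb pb).
have pg : pos (g • (w • b)).
  by have := gJ'.2 _ (root_geom w rb) pwb perp_wb; rewrite invgK.
apply: (vw.2) => //; first by do 2 apply: root_geom.
by have := perp_fix gJ'.1 perp_wb; rewrite invgK.
Qed.

(** * The dimension bound for groups of elements fixing [J] *)

Section Subgroup.
Context (H : groupType) (iota : H -> W).
Hypothesis iotaM : {morph iota : x y / (x * y)%g}.
Hypothesis iota_inj : injective iota.
Hypothesis iota_fixes : forall h, fixes_J (iota h).

Let act h := translate (iota h).

Let act1 F : act 1%g F = F.
Proof. by rewrite /act (morph_mulg1 iotaM) translate1. Qed.

Let actM (g h : H) F : act (g * h)%g F = act g (act h F).
Proof. by rewrite /act iotaM translateM. Qed.

Let act_free h F : is_cap compat cap F -> act h F = F -> h = 1%g.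
Proof.
move=> [s [[w ws] s0 FE]] hF; apply: iota_inj; rewrite (morph_mulg1 iotaM).
apply: (@fixes_J_free _ w F) hF => //.
- by rewrite -(morph_mulgV iotaM).
- by case: ws.
- by rewrite FE; exact: cap_cell.
Qed.

(** A representative of each orbit; [vert F] is an element carrying it to [F]. On caps the action is
    free, so this element is unique and hence equivariant. *)
Let rep F : set W := xget set0 [set G | exists h, act h G = F].

Let vert F : H := xget 1%g [set h | act h (rep F) = F].

Let vertP F : act (vert F) (rep F) = F.
Proof.
have [h hF] : exists h, act h (rep F) = F.
  apply: (@xgetPex _ set0 [set G | exists h, act h G = F]).
  by exists F, 1%g; exact: act1.
exact: (@xgetPex _ 1%g [set h | act h (rep F) = F] (ex_intro _ h hF)).
Qed.

Let rep_act h F : rep (act h F) = rep F.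
Proof.
rewrite /rep; congr xget; apply/seteqP; split => G [k E].
  by exists (h^-1 * k)%g; rewrite actM E -actM mulVg act1.
by exists (h * k)%g; rewrite actM E.
Qed.

Let vert_act h F : is_cap compat cap F -> vert (act h F) = (h * vert F)%g.
Proof.
move=> Fc; have E : (h^-1 * vert (act h F) * (vert F)^-1 = 1)%g.
  apply: (act_free Fc); rewrite -[F in act _ F]vertP -actM -!mulgA mulVg mulg1.
  by rewrite -(rep_act h) actM vertP -actM mulVg act1.
apply: (mulgI h^-1%g); apply: (mulIg (vert F)^-1%g).
by rewrite E !mulgA mulVg mul1g mulgV.
Qed.

Lemma fixes_J_cohomological_dimension : cohomological_dimension_le H (rank_bound J).
Proof.
apply: (@cohomological_dimension_bound H (set W) act compat apex level cap rk vert).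
- exact: act1.
- exact: actM.
- exact: compat_nil.
- by move=> s t; exact: compat_sub.
- by move=> h s; exact: compat_translate.
- exact: apexP.
- exact: levelP.
- exact: capP.
- by move=> g s _; exact: cap_translate.
- exact: rk_le.
- exact: vert_act.
Qed.

End Subgroup.

End Cells.

(** * The kernel *)

Section DualCone.
Context (R : realType) (S : coxeter_system).
Notation W := (cs_group S).
Notation Pi := (cs_index S).
Notation gen := (@cs_gen S).
Notation V := (cox_V R S).
Notation e := (@simple_root R S).
Notation "w • v" := (bij_fun (@geom R S w) v) (at level 40, left associativity).
Notation fixed_dual := (@fixed_dual R S).
Context (J : set Pi).
Implicit Types (w : W) (b v : V) (x y : dual V).

Lemma act_cox w v : act (cox_sd w) v = w • v.
Proof. by rewrite /act perm_act1. Qed.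

Lemma cox_sdV w : ((cox_sd w)^-1)%g = cox_sd w^-1%g.
Proof.
rewrite /cox_sd -[LHS]/(sd_inv _) /sd_inv /=; congr Semidirect; last exact: invg1.
by rewrite invg1 cox_aut_one.
Qed.

Lemma dact_cox w x v : dact (cox_sd w) x v = x (w^-1%g • v).
Proof. by rewrite /= cox_sdV act_cox. Qed.

Lemma dual_linear x : linear (dual_fun x).
Proof. by have /asboolP := dual_fun_linear x. Qed.

Lemma dualD x u v : x (u + v) = x u + x v.
Proof. by have := dual_linear x 1 u v; rewrite !scale1r. Qed.

Lemma dual0 x : x 0 = 0.
Proof. by apply: (addrI (x 0)); rewrite -dualD !addr0. Qed.

Lemma dualZ x a v : x (a *: v) = a * x v.
Proof. by have := dual_linear x a v 0; rewrite dual0 !addr0. Qed.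

Lemma dualN x v : x (- v) = - x v.
Proof. by rewrite -scaleN1r dualZ mulN1r. Qed.

Lemma dual_add x y v : (x + y) v = x v + y v. Proof. by []. Qed.
Lemma dual_scale a x v : (a *: x) v = a * x v. Proof. by []. Qed.
Lemma dual_opp x v : (- x) v = - x v. Proof. by []. Qed.
Lemma dual_ge0 x v : (forall s, 0 <= (x (e s) : R)) -> pos v -> 0 <= (x v : R).
Proof.
move=> xe pv; rewrite (coordE v); elim/big_ind: _ => //.
- by rewrite dual0.
- by move=> a b a0 b0; rewrite dualD addr_ge0.
- by move=> s _; rewrite dualZ mulr_ge0.
Qed.

Definition eval_at v : dual V -> R := fun x => x v.

Lemma eval_at_linear_for v : linear_for *%R (eval_at v).
Proof. by []. Qed.

HB.instance Definition _ v :=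
  GRing.isLinear.Build R (dual V) R *%R (eval_at v) (eval_at_linear_for v).

Definition off_J : V -> R^o := lin_ext (fun s => (`[< ~ J s >])%:R : R^o).

Lemma off_J_linear : off_J \in @lin_forms R V.
Proof. by apply/asboolP; exact: lin_ext_linear. Qed.

(* The generic point of the face of the fundamental chamber fixed by W_J. *)
Definition face_point : dual V := Dual off_J_linear.

Lemma face_point_e s : face_point (e s) = (`[< ~ J s >])%:R.
Proof. exact: lin_extU. Qed.

Lemma face_point_e_ge0 s : 0 <= (face_point (e s) : R).
Proof. by rewrite face_point_e ler0n. Qed.

Lemma face_point_vanish v : vanish J v -> face_point v = 0.
Proof.
move=> Jv; rewrite (coordE v) big_seq; elim/big_ind: _ => [|x y x0 y0|s sv].
- exact: dual0.
- by rewrite dualD x0 y0 addr0.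
have Js := vanish_supp Jv sv.
by rewrite dualZ face_point_e asboolF ?mulr0//; exact.
Qed.

Lemma face_point_gt0 v : pos v -> ~ vanish J v -> 0 < (face_point v : R).
Proof.
move=> pv nv; have [t nJt vt] : exists2 t, ~ J t & v@_t != 0.
  apply: contrapT => nt; apply: nv => t nJt; apply/eqP; apply: contrapT => /negP vt.
  by apply: nt; exists t.
have -> : v = v@_t *: e t + (v - v@_t *: e t) by rewrite addrC subrK.
rewrite dualD dualZ face_point_e asboolT// mulr1; apply: ltr_wpDr.
  apply: dual_ge0 => [s|s]; first exact: face_point_e_ge0.
  rewrite mcoeffB mcoeffZ mcoeff_e; case: eqVneq => [<-|_].
    by rewrite mulr1 subrr.
  by rewrite mulr0 subr0; exact: pv.
by rewrite lt_def vt; exact: pv.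
Qed.

Lemma face_point_fixed : fixed_dual J face_point.
Proof.
move=> w Jw; apply: dualP => v; rewrite dact_cox.
apply/eqP; rewrite -subr_eq0 -dualN -dualD; apply/eqP/face_point_vanish => t nJt.
by rewrite mcoeffB (par_coef _ (parV Jw))// subrr.
Qed.

Lemma pos_roots_root b : pos_roots b -> is_root b /\ pos b.
Proof. by move=> [[w [s E]] pb]; split=> //; exists w, s; rewrite E act_cox. Qed.

Lemma face_point_C_Pi : finite_type R J -> C_Pi face_point.
Proof.
move=> fJ; split; first exact: face_point_e_ge0.
apply: sub_finite_set fJ => b [/pos_roots_root[rb pb] n]; split=> //.
by apply: contrapT => nv; apply: n; exact: face_point_gt0.
Qed.

(** A root in the span of [J] and orthogonal to it would have norm 0 instead of 2. *)
Lemma perp_not_vanish b : is_root b -> perp J b -> ~ vanish J b.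
Proof.
move=> rb pJ Jb; have := bil_root rb; suff -> : bil b b = 0.
  by move/esym/eqP; rewrite pnatr_eq0.
rewrite {2}(coordE b) big_seq; elim/big_ind: _ => [|x y x0 y0|s sb].
- exact: bil0r.
- by rewrite bilDr x0 y0 addr0.
by rewrite bilZr pJ ?mulr0//; exact: vanish_supp sb.
Qed.

Lemma fixed_dualD p q x y : fixed_dual J x -> fixed_dual J y ->
  fixed_dual J (p *: x + q *: y).
Proof.
move=> Jx Jy w Jw; apply: dualP => v.
by rewrite dact_cox !dual_add !dual_scale -!dact_cox Jx// Jy.
Qed.

(** * Reflections in roots orthogonal to [J], and the chamber of [W_Omega] *)

Context (GPi : subgroup (diagram_aut S)) (GJ RJ : subgroup (sub_aut J)).
Notation W_Omega := (@W_Omega R S GPi J GJ RJ).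
Notation C_Omega := (@C_Omega R S GPi J GJ RJ).

Lemma W_Omega_sub h : W_Omega h ->
  sd_aut h = 1%g /\ exists f, @acts_on_J_as R S J h f.
Proof.
pose A : set (semidirect S) :=
  [set h | sd_aut h = 1%g /\ exists f, @acts_on_J_as R S J h f].
move=> hW; apply: (hW A); split=> [|h' [[w _ <-] _ _ [f _ hf]]]; last by split=> //; exists f.
split; rewrite ?inE /=.
- by split=> //; exists 1%g; exact: acts_on_J1.
- move=> x y; rewrite !inE /= => -[x1 [f xf]] [y1 [k yk]]; split.
    by rewrite -[sd_aut _]/(sd_aut x * sd_aut y)%g x1 y1 mulg1.
  by exists (f * k)%g; exact: acts_on_JM.
- move=> x; rewrite !inE /= => -[x1 [f xf]]; split.
    by rewrite -[sd_aut _]/((sd_aut x)^-1)%g x1 invg1.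
  by exists (f^-1)%g; exact: acts_on_JV.
Qed.

(* If a reflection w in W_Omega separated c from the face point, it would fix a
   generic point x of the face between them; a descent s of w^-1, which is not in J,
   then gives x (e_s) > 0 >= x (w^-1 e_s) = x (e_s). *)
Lemma face_point_C_Omega : finite_type R J -> C_Omega face_point.
Proof.
move=> fJ; split; [|exact: face_point_fixed|].
  exists 1%g => //; exists face_point; first exact: face_point_C_Pi.
  by apply: dualP => v; rewrite dact_cox invg1 geom1.
move=> g alpha /W_Omega_sub[g1 [f gf]] [a [Ua aa] gU] c [c0 _] Uc lt0.
have [w gw] : exists w, g = cox_sd w by case: g g1 {gf gU} => w h /= ->; exists w.
(* The values of [alpha] at the two points have opposite signs; these weights make [alpha] vanish on
   the combination [x]. *)
pose p := `|alpha face_point|; pose q := `|alpha c|.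
have p0 : 0 < p by rewrite normr_gt0; apply: contraTneq lt0 => ->; rewrite mulr0 ltxx.
have q0 : 0 < q by rewrite normr_gt0; apply: contraTneq lt0 => ->; rewrite mul0r ltxx.
pose x := p *: c + q *: face_point.
have Ux : fixed_dual J x by apply: fixed_dualD => //; exact: face_point_fixed.
have ax : alpha x = 0.
  rewrite linearD !linearZ /= /p /q; move: lt0; set k := alpha c; set l := alpha face_point.
  case: (ltgtP k 0) => [k0|k0|->]; last by rewrite mul0r ltxx.
  - rewrite nmulr_rlt0// => l0; rewrite gtr0_norm// ltr0_norm//; ring.
  - rewrite pmulr_rlt0// => l0; rewrite ltr0_norm// gtr0_norm//; ring.
have xe s : 0 <= (x (e s) : R).
  rewrite dual_add !dual_scale addr_ge0// mulr_ge0 ?(ltW p0) ?(ltW q0)//.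
  exact: face_point_e_ge0.
have xw v : x (w^-1%g • v) = x v.
  by rewrite -dact_cox -gw gU// ax scale0r subr0.
(* The identity is no reflection: it would give a = a - 2 a, against alpha a = 2. *)
have [w1|w1] := pselect (w^-1%g = 1%g).
  have g1' : g = 1%g by rewrite gw -[w]invgK w1 invg1.
  have := gU a Ua; rewrite g1' dact1 aa => /eqP; rewrite eq_sym subr_eq -subr_eq0 opprD.
  rewrite addrA subrr sub0r oppr_eq0 => /eqP a2.
  have : alpha (2 *: a) = 0 by rewrite a2 linear0.
  by rewrite linearZ /= aa => /eqP; rewrite mulf_eq0 pnatr_eq0.
have [s neg] := exists_neg R w1.
have nJs : ~ J s.
  move=> Js; have gV := acts_on_JV gf.
  have := gV (SigSub (mem_set Js)).
  rewrite gw cox_sdV act_cox /= => E; move: neg; rewrite E.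
  by apply: root_not_pos; [exact: root_e|exact: pos_e].
have := dual_ge0 xe neg; rewrite dualN xw oppr_ge0 leNgt => /negP; apply.
rewrite dual_add !dual_scale face_point_e asboolT// mulr1.
by apply: ltr_wpDl => //; apply: mulr_ge0; [exact: ltW|exact: c0].
Qed.

Definition root_refl w s : W := (w * gen s * w^-1)%g.

Lemma root_reflE w s v :
  root_refl w s • v = v - bil v (w • e s) *: (w • e s).
Proof.
have E : bil (w^-1%g • v) (e s) = bil v (w • e s) by rewrite bil_geoml invgK.
by rewrite /root_refl !geomMv geom_genE geomD geomN geomZ geomVKv E.
Qed.

Lemma perp_par b w : perp J b -> parabolic J w -> w • b = b.
Proof.
move=> pJ; elim/par_ind => [|s Js|x y IHx IHy|x IH].
- exact: geom1.
- by rewrite geom_genE pJ// scale0r subr0.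
- by rewrite geomMv IHy IHx.
- by rewrite -{1}IH geomKv.
Qed.

Lemma coroot_subproof b : (fun v => bil v b : R^o) \in @lin_forms R V.
Proof. by apply/asboolP; exact: bil_linl. Qed.

Definition coroot b : dual V := Dual (coroot_subproof b).

(** Orthogonality to [J] makes the coroot invariant under W_J, so the reflection vector lies in the
    fixed subspace. *)
Lemma root_refl_acts w s : perp J (w • e s) ->
  acts_as_reflection (fixed_dual J) (cox_sd (root_refl w s)) (eval_at (w • e s)).
Proof.
set b := w • e s => pJ; exists (coroot b).
  split; last by rewrite /eval_at /= bil_geom bil_ss.
  move=> u Ju; apply: dualP => v; rewrite dact_cox /= bil_geoml invgK.
  by rewrite perp_par.
move=> x _; apply: dualP => v; rewrite dact_cox.
rewrite dual_add dual_opp dual_scale /=.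
have -> : ((root_refl w s)^-1 = root_refl w s)%g.
  by rewrite /root_refl !invgM invgK genV mulgA.
by rewrite root_reflE dualD dualN dualZ mulrC.
Qed.

(** Such a reflection fixes every e_j, so it acts on [J] as the identity, which belongs to R. *)
Lemma root_refl_W_Omega w s : perp J (w • e s) -> W_Omega (cox_sd (root_refl w s)).
Proof.
move=> pJ A [_]; apply.
have on_J : @acts_on_J_as R S J (cox_sd (root_refl w s)) 1%g.
  move=> j; rewrite act_cox root_reflE bilC pJ ?scale0r ?subr0//.
  by have := valP j; rewrite inE.
split.
- by exists (root_refl w s).
- split; first by exact: sg_set1.
  by exists 1%g => //; exact: sg_set1.
- by exists (eval_at (w • e s)); exact: root_refl_acts.
- by exists 1%g => //; exact: sg_set1.
Qed.

(** If w^-1 b were negative, the face point and its image under w would take values of opposite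
    signs at b. Both are nonzero, because neither b nor w^-1 b lies in the span of [J]; so the
    reflection in b would strictly separate the two points. *)
Lemma Gamma_Omega_pos w : finite_type R J ->
  (forall j, J j -> w • e j = e j) ->
  dact (cox_sd w) @` C_Omega = C_Omega ->
  forall b, is_root b -> pos b -> perp J b -> pos (w^-1%g • b).
Proof.
move=> fJ wJ wC b rb pb pJ.
case: (root_sign (root_geom w^-1%g rb)) => // neg; exfalso.
have : C_Omega (dact (cox_sd w) face_point).
  by rewrite -wC; exists face_point => //; exact: face_point_C_Omega.
move: (rb) => [u [s bE]]; rewrite bE in pJ.
move=> [_ _ /(_ _ _ (root_refl_W_Omega pJ) (root_refl_acts pJ) _
  (face_point_C_Pi fJ) face_point_fixed)].
apply; rewrite -bE in pJ *.
change ((face_point b : R) * (dact (cox_sd w) face_point b : R) < 0); rewrite dact_cox.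
rewrite pmulr_rlt0; last by apply: face_point_gt0 => //; exact: perp_not_vanish.
rewrite -oppr_gt0 -dualN; apply: face_point_gt0 => // vJ.
apply: (perp_not_vanish (root_opp (root_geom w^-1%g rb))) vJ.
by move=> j Jj; rewrite bilNl (perp_fix wJ pJ)// oppr0.
Qed.

End DualCone.

(** * Embedding of the kernel into the Coxeter group *)

Section Kernel.
Context (R : realType) (S : coxeter_system).
Context (GPi : subgroup (diagram_aut S)) (J : set (cs_index S)).
Context (GJ RJ : subgroup (sub_aut J)).

Let H := sg_type (ker (natural_map R GPi GJ RJ)).

Definition ker_elt (k : H) : semidirect S := val (val k).

Lemma ker_elt_aut (k : H) : sd_aut (ker_elt k) = 1%g.
Proof. by have := valP k; rewrite inE => /(congr1 (fun p => val p.2)). Qed.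

Lemma ker_eltE (k : H) : ker_elt k = cox_sd (sd_cox (ker_elt k)).
Proof. by have := ker_elt_aut k; case: (ker_elt k) => w f /= ->. Qed.

Lemma ker_elt_J (k : H) j : J j ->
  geom R (sd_cox (ker_elt k)) (simple_root R j) = simple_root R j.
Proof.
move=> Jj; have := valP k; rewrite inE => /(congr1 (fun p => val p.1)) k1.
have {}k1 : val (act_on_J (val k)) = 1%g := k1.
have := act_on_JP (val k) (SigSub (mem_set Jj)).
by rewrite k1 -/(ker_elt k) ker_eltE act_cox.
Qed.

Lemma ker_elt_C (k : H) : dact (ker_elt k) @` @C_Omega R S GPi J GJ RJ = @C_Omega R S GPi J GJ RJ.
Proof. by have := valP (val k); rewrite inE => -[]. Qed.

Definition ker_cox (k : H) : cs_group S := sd_cox (ker_elt k).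

(** The diagram part of a kernel element is trivial, so the twist in the semidirect product
    disappears. *)
Lemma ker_coxM : {morph ker_cox : k l / (k * l)%g}.
Proof.
move=> k l; rewrite {1}/ker_cox.
have -> : ker_elt (k * l)%g = (ker_elt k * ker_elt l)%g by [].
rewrite -[LHS]/(ker_cox k * cox_aut (sd_aut (ker_elt k)) (ker_cox l))%g.
by rewrite ker_elt_aut cox_aut_one.
Qed.

Lemma ker_cox_inj : injective ker_cox.
Proof.
move=> k l E; apply/val_inj/val_inj; rewrite -!/(ker_elt _) ker_eltE [RHS]ker_eltE.
by rewrite -!/(ker_cox _) E.
Qed.

End Kernel.

Theorem theorem4p1 (R : realType) (S : coxeter_system)
    (GammaPi : subgroup (diagram_aut S)) (J : set (cs_index S))
    (GammaJ RJ : subgroup (sub_aut J)) :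
  spherical J -> normal_in RJ GammaJ ->
  finite_cohomological_dimension (sg_type (ker (natural_map R GammaPi GammaJ RJ))).
Proof.
move=> /(spherical_finite_type R) fJ _; exists (rank_bound J).
apply: (fixes_J_cohomological_dimension fJ (@ker_coxM _ _ _ _ _ _) (@ker_cox_inj _ _ _ _ _ _)).
move=> k; have kJ := @ker_elt_J _ _ _ _ _ _ k; split=> //.
apply: (Gamma_Omega_pos (GPi := GammaPi) (GJ := GammaJ) (RJ := RJ)) => //.
by rewrite -ker_eltE; exact: ker_elt_C.
Qed.
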